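(* Let $s\geq 3$ and let $n=ms+r$ with integers $m\geq 0$ and $0\leq r\leq s-1$. Then $$\dim_K\mathrm{HH}^{ms+r}(\Lambda_s)=\begin{cases} ms+1 & \text{if } r=0 \text{ and } (s \text{ is even, or } m \text{ is even, or } \operatorname{char}K=2),\\ 2ms+4 & \text{if } r=1 \text{ and } (s \text{ is even, or } m \text{ is even, or } \operatorname{char}K=2),\\ ms+3 & \text{if } r=2 \text{ and } (s \text{ is even, or } m \text{ is even, or } \operatorname{char}K=2),\\ 0 & \text{otherwise.}\end{cases}$$
   Context: $K$ is an algebraically closed field. For $s\geq 1$, $\Gamma_s$ is the circular quiver with double arrows: its vertices are $0,1,\dots,s-1$ (indices modulo $s$) and for each $i$ there are exactly two arrows $a_i,b_i$ from $i$ to $i+1$. Paths are composed from left to right. Put $x=\sum_{i=0}^{s-1}a_i$ and $y=\sum_{i=0}^{s-1}b_i$ in the path algebra $K\Gamma_s$. Let $I=\langle x^2,xy+yx,y^2\rangle$ (two-sided ideal) and $\Lambda_s=K\Gamma_s/I$. Let $\Lambda_s^e=\Lambda_s^{\mathrm{op}}\otimes_K\Lambda_s$ be the enveloping algebra. The $n$-th Hochschild cohomology group is the $K$-space $\mathrm{HH}^n(\Lambda_s)=\mathrm{Ext}^n_{\Lambda_s^e}(\Lambda_s,\Lambda_s)$. *)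

(* Defs.v *)
From HB Require Import structures.
From mathcomp Require Import all_boot all_order all_algebra ring_quotient finmap.
From mathcomp Require Import boolp functions.
From mathcomp Require Import monalg.

Set Implicit Arguments.
Unset Strict Implicit.
Unset Printing Implicit Defensive.

Import GRing.Theory.
Local Open Scope ring_scope.
Local Open Scope quotient_scope.

Section LinearExtension.
Variables (R : nzRingType) (B : choiceType) (V : lmodType R) (f : B -> V).

Definition lext (g : {malg R[B]}) : V := \sum_(b <- msupp g) g@_b *: f b.

Lemma lextw (D : {fset B}) (g : {malg R[B]}) : {subset msupp g <= D} ->
  lext g = \sum_(b <- D) g@_b *: f b.
Proof.
move=> /fsubsetP sgD; rewrite /lext; apply: big_fset_incl => // b _ bNg.
by rewrite mcoeff_outdom // scale0r.
Qed.

Lemma lext_linear : linear lext.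
Proof.
move=> k g h.
pose D := (msupp (k *: g + h) `|` (msupp g `|` msupp h))%fset.
rewrite !(@lextw D).
- rewrite scaler_sumr -big_split /=; apply: eq_bigr => b _.
  by rewrite mcoeffD mcoeffZ scalerDl scalerA.
- by move=> b bh; rewrite !in_fsetU bh !orbT.
- by move=> b bg; rewrite !in_fsetU bg !orbT.
- by move=> b bg; rewrite !in_fsetU bg.
Qed.

HB.instance Definition _ :=
  GRing.isLinear.Build R {malg R[B]} V *:%R lext lext_linear.

Lemma lextU b : lext << b >> = f b.
Proof.
rewrite (@lextw [fset b]%fset) ?big_seq_fset1 ?mcoeffUU ?scale1r //.
by move=> c; rewrite msuppU oner_eq0.
Qed.

End LinearExtension.

Lemma malg_sumE (R : nzRingType) (B : choiceType) (g : {malg R[B]}) :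
  g = \sum_(b <- msupp g) g@_b *: << b >>.
Proof.
rewrite {1}(monalgE g); apply: eq_bigr => b _; apply/malgP => c.
by rewrite mcoeffZ !mcoeffU mulr_natr.
Qed.

Lemma malg_linP (R : nzRingType) (B : choiceType) (V : lmodType R)
    (u v : {malg R[B]} -> V) :
  linear u -> linear v -> (forall b, u << b >> = v << b >>) -> u =1 v.
Proof.
move=> lu lv uv g.
pose U := GRing.isLinear.Build _ _ _ _ u lu.
pose W := GRing.isLinear.Build _ _ _ _ v lv.
pose u' : {linear _ -> _} := HB.pack u U.
pose v' : {linear _ -> _} := HB.pack v W.
rewrite [g]malg_sumE -[u]/(u' : _ -> _) -[v]/(v' : _ -> _) !linear_sum.
by apply: eq_bigr => b _; rewrite !linearZ /= uv.
Qed.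

(* {malg K[B]} is the vector space with basis B.  A mul_table is an algebra
   structure on it: the products of basis elements and the unit. *)
Section StructureConstants.
Variables (K : fieldType) (B : choiceType).

Definition bilext (m : B -> B -> {malg K[B]}) (g h : {malg K[B]}) : {malg K[B]} :=
  lext (fun p => lext (m p) h) g.

Lemma bilext_linearl m h : linear (bilext m ^~ h).
Proof. exact: lext_linear. Qed.

Lemma bilext_linearr m g : linear (bilext m g).
Proof.
move=> k h1 h2; rewrite /bilext /lext scaler_sumr -big_split /=.
apply: eq_bigr => p _; rewrite -!/(lext _ _) linearP scalerDr !scalerA.
by rewrite mulrC.
Qed.

Lemma bilextU m p q : bilext m << p >> << q >> = m p q.
Proof. by rewrite /bilext !lextU. Qed.

Record mul_table := MulTable {
  tmul : B -> B -> {malg K[B]};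
  tone : {malg K[B]};
  _ : forall p q r, bilext tmul (tmul p q) << r >> = bilext tmul << p >> (tmul q r);
  _ : forall p, bilext tmul tone << p >> = << p >>;
  _ : forall p, bilext tmul << p >> tone = << p >>;
  _ : tone != 0 }.

Definition basis_alg (t : mul_table) : Type := {malg K[B]}.

Variable t : mul_table.
Local Notation A := (basis_alg t).

HB.instance Definition _ := GRing.Lmodule.on A.

Definition bmul : A -> A -> A := bilext (tmul t).

Fact bmulDl : left_distributive bmul +%R.
Proof.
move=> x y z; have := bilext_linearl (tmul t) z 1 x y.
by rewrite !scale1r.
Qed.

Fact bmulDr : right_distributive bmul +%R.
Proof.
move=> x y z; have := bilext_linearr (tmul t) x 1 y z.
by rewrite !scale1r.
Qed.

Fact bscaleAl k x y : k *: bmul x y = bmul (k *: x) y.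
Proof.
have := bilext_linearl (tmul t) y k x 0.
have /(congr1 (+%R (- bmul 0 y))) := bmulDl 0 0 y.
by rewrite addr0 addNr addKr addr0 /bmul => <-; rewrite addr0 => ->.
Qed.

Fact bscaleAr k x y : k *: bmul x y = bmul x (k *: y).
Proof.
have := bilext_linearr (tmul t) x k y 0.
have /(congr1 (+%R (- bmul x 0))) := bmulDr x 0 0.
by rewrite addr0 addNr addKr addr0 /bmul => <-; rewrite addr0 => ->.
Qed.

Fact bmulA : associative bmul.
Proof.
have tA p q r : bilext (tmul t) << p >> (tmul t q r) =
                bilext (tmul t) (tmul t p q) << r >>.
  by case: (t) => m u mA *; exact/esym/mA.
move=> x y z; move: x.
apply: malg_linP => [k x1 x2|k x1 x2|p].
- by rewrite /bmul bilext_linearl.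
- by rewrite /bmul !bilext_linearl.
move: y; apply: malg_linP => [k y1 y2|k y1 y2|q].
- by rewrite /bmul bilext_linearl bilext_linearr.
- by rewrite /bmul bilext_linearr bilext_linearl.
move: z; apply: malg_linP => [k z1 z2|k z1 z2|r].
- by rewrite /bmul !bilext_linearr.
- by rewrite /bmul bilext_linearr.
by rewrite /bmul !bilextU tA.
Qed.

Fact bmul1 : left_id (tone t : A) bmul.
Proof.
apply: malg_linP => // [k x y|p]; first by rewrite /bmul bilext_linearr.
by rewrite /bmul; case: (t).
Qed.

Fact bmulr1 : right_id (tone t : A) bmul.
Proof.
apply: malg_linP => // [k x y|p]; first by rewrite /bmul bilext_linearl.
by rewrite /bmul; case: (t).
Qed.

Fact bone_neq0 : (tone t : A) != 0.
Proof. by case: (t). Qed.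

HB.instance Definition _ := GRing.Zmodule_isNzRing.Build A
  bmulA bmul1 bmulr1 bmulDl bmulDr bone_neq0.
HB.instance Definition _ := GRing.Lmodule_isLalgebra.Build K A bscaleAl.
HB.instance Definition _ := GRing.Lalgebra_isAlgebra.Build K A bscaleAr.

Lemma basis_algM (p q : B) : (<< p >> : A) * (<< q >> : A) = tmul t p q.
Proof. exact: bilextU. Qed.

End StructureConstants.

(* Paths compose from left to right.  Quivers are nonempty, as path algebras
   are nonzero rings. *)
Record quiver := Quiver {
  vertex : finType;
  arrow : finType;
  source : arrow -> vertex;
  target : arrow -> vertex;
  _ : (0 < #|vertex|)%N }.

Section PathAlgebra.
Variables (K : fieldType) (Q : quiver).

(* (v, [:: a_1; ..; a_n]) with v = source a_1, target a_i = source a_(i+1);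
   the second component is empty for the trivial path e_v. *)
Fixpoint composable (v : vertex Q) (w : seq (arrow Q)) : bool :=
  if w is a :: w' then (source a == v) && composable (target a) w' else true.

Definition qpath := {x : vertex Q * seq (arrow Q) | composable x.1 x.2}.

HB.instance Definition _ := Choice.on qpath.

Definition path_source (p : qpath) : vertex Q := (val p).1.
Definition path_target (p : qpath) : vertex Q :=
  last (path_source p) (map (@target Q) (val p).2).

Lemma composable_cat v w1 w2 : composable v (w1 ++ w2) =
  composable v w1 && composable (last v (map (@target Q) w1)) w2.
Proof. by elim: w1 v => //= a w1 IH v; rewrite IH andbA. Qed.

Fact path_cat_subproof (p q : qpath) : path_target p == path_source q ->
  composable (path_source p) ((val p).2 ++ (val q).2).
Proof.
move=> /eqP pq; rewrite composable_cat (valP p) /=.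
by rewrite -/(path_target p) pq (valP q).
Qed.

Definition path_cat (p q : qpath) (pq : path_target p == path_source q) : qpath :=
  exist (fun x => composable x.1 x.2)
    (path_source p, (val p).2 ++ (val q).2) (path_cat_subproof pq).

Definition trivial_path (v : vertex Q) : qpath :=
  exist (fun x => composable x.1 x.2) (v, [::]) isT.

Fact arrow_path_subproof (a : arrow Q) : composable (source a) [:: a].
Proof. by rewrite /= eqxx. Qed.

Definition arrow_path (a : arrow Q) : qpath :=
  exist (fun x => composable x.1 x.2) (source a, [:: a]) (arrow_path_subproof a).

Definition path_mul (p q : qpath) : {malg K[qpath]} :=
  if @idP (path_target p == path_source q) is ReflectT pq
  then << path_cat pq >> else 0.

Definition path_one : {malg K[qpath]} := \sum_v << trivial_path v >>.

Lemma path_mulE (p q r : qpath) : path_target p = path_source q ->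
  val r = (path_source p, (val p).2 ++ (val q).2) -> path_mul p q = << r >>.
Proof.
move=> pq rE; rewrite /path_mul; destruct idP as [pq'|[]]; last by rewrite pq.
by congr << _ >>; apply/val_inj; rewrite rE.
Qed.

Lemma path_mul0 (p q : qpath) :
  path_target p != path_source q -> path_mul p q = 0.
Proof. by rewrite /path_mul => pq; destruct idP => //; case/negP: pq. Qed.

Lemma path_target_cat p q pq : path_target (@path_cat p q pq) = path_target q.
Proof.
rewrite /path_target /= map_cat last_cat -/(path_target p).
by rewrite (eqP pq).
Qed.

Lemma bilext0l m (h : {malg K[qpath]}) : bilext m 0 h = 0.
Proof. by rewrite /bilext linear0. Qed.

Lemma bilext0r m (h : {malg K[qpath]}) : bilext m h 0 = 0.
Proof. by rewrite /bilext /lext big1 // => p _; rewrite -/(lext _ _) linear0 scaler0. Qed.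

Lemma path_mul_cat p q pq : path_mul p q = << @path_cat p q pq >>.
Proof. exact: path_mulE (eqP pq) _. Qed.

Fact path_mulA p q r : bilext path_mul (path_mul p q) << r >> =
  bilext path_mul << p >> (path_mul q r).
Proof.
have [pq|pNq] := boolP (path_target p == path_source q); last first.
  rewrite (path_mul0 pNq) bilext0l.
  have [qr|qNr] := boolP (path_target q == path_source r).
    by rewrite (path_mul_cat qr) bilextU path_mul0.
  by rewrite (path_mul0 qNr) bilext0r.
rewrite (path_mul_cat pq) bilextU.
have [qr|qNr] := boolP (path_target q == path_source r); last first.
  by rewrite (path_mul0 qNr) bilext0r path_mul0 // path_target_cat.
rewrite (path_mul_cat qr) bilextU.
have pqr : path_target p == path_source (path_cat qr) := pq.
rewrite (path_mul_cat pqr).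
by apply: path_mulE; rewrite ?path_target_cat ?(eqP qr) //= -catA.
Qed.

Fact path_mul1 p : bilext path_mul path_one << p >> = << p >>.
Proof.
rewrite /bilext linear_sum /= (bigD1 (path_source p)) //= big1 => [|v vNp].
  rewrite !lextU addr0; apply: path_mulE => //=.
  by case: p => -[].
by rewrite !lextU path_mul0.
Qed.

Fact path_mulr1 p : bilext path_mul << p >> path_one = << p >>.
Proof.
rewrite /bilext lextU linear_sum /= (bigD1 (path_target p)) //= big1 => [|v vNp].
  rewrite !lextU addr0; apply: path_mulE => //=.
  by rewrite cats0; case: p => -[].
by rewrite lextU path_mul0 // eq_sym.
Qed.

Lemma mcoeff_path_one v : path_one@_(trivial_path v) = 1.
Proof.
rewrite raddf_sum (bigD1 v) //= mcoeffUU big1 ?addr0 // => w wNv.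
rewrite mcoeffU; case: eqP => // /(congr1 (fun p => (val p).1)) /= wv.
by rewrite wv eqxx in wNv.
Qed.

Fact path_one_neq0 : path_one != 0.
Proof.
have /card_gt0P[v _] : (0 < #|vertex Q|)%N by case: (Q).
apply/eqP => /(congr1 (mcoeff (trivial_path v))).
by rewrite mcoeff_path_one mcoeff0 => /eqP; rewrite oner_eq0.
Qed.

Definition path_table := MulTable path_mulA path_mul1 path_mulr1 path_one_neq0.

Definition path_algebra := basis_alg path_table.
HB.instance Definition _ := GRing.Algebra.on path_algebra.

Definition path_elt (p : qpath) : path_algebra := << p >>.

Lemma mcoeff_trivialM (g h : path_algebra) v :
  (g * h)@_(trivial_path v) = g@_(trivial_path v) * h@_(trivial_path v).
Proof.
move: g; apply: (@malg_linP _ _ K^o) => [k g g'|k g g'|p].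
- by rewrite mulrDl -scalerAl mcoeffD mcoeffZ.
- by rewrite mcoeffD mcoeffZ mulrDl -mulrA.
move: h; apply: (@malg_linP _ _ K^o) => [k h h'|k h h'|q].
- by rewrite mulrDr -scalerAr mcoeffD mcoeffZ.
- by rewrite mcoeffD mcoeffZ mulrDr mulrCA.
rewrite (basis_algM path_table) /= !mcoeffU mulr_natr -mulrnA mulnb.
have trivE (r : qpath) : (r == trivial_path v) = (path_source r == v) && nilp (val r).2.
  by rewrite -val_eqE /path_source /nilp size_eq0; case: (val r).
have targE : p = trivial_path v -> path_target p = v by move=> ->.
have [pq|pNq] := boolP (path_target p == path_source q).
  rewrite (path_mul_cat pq) mcoeffU; congr (_ *+ nat_of_bool _).
  have [ptriv|] := eqVneq p (trivial_path v); last first.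
    by apply: contraNF; rewrite !trivE /= cat_nilp andbA => /andP[].
  have := ptriv; move/eqP; rewrite !trivE -(eqP pq) targE //= => /andP[-> /nilP->].
  by rewrite eqxx.
rewrite (path_mul0 pNq) mcoeff0.
case: eqP => //= ptriv; case: eqP => //= qtriv.
by case/eqP: pNq; rewrite targE // qtriv.
Qed.

End PathAlgebra.

Section QuotientModule.
Variables (R : pzRingType) (V : lmodType R).
Variables (W : {pred V}) (Wsub : submod_closed W).

Definition sub_zmodClosed : zmodClosed V :=
  HB.pack W (GRing.isZmodClosed.Build V W (GRing.submod_closedB Wsub)).

Definition quot_mod : Type := Quotient.quot sub_zmodClosed.

HB.instance Definition _ := Choice.on quot_mod.
HB.instance Definition _ := GRing.Zmodule.on quot_mod.

Definition quot_proj (v : V) : quot_mod := \pi_(Quotient.quot sub_zmodClosed) v.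

Lemma quot_projP u v : quot_proj u = quot_proj v <-> u - v \in W.
Proof.
have e := Quotient.idealrBE sub_zmodClosed u v.
by split=> [/eqP|uv]; [rewrite -[_ == _]e | apply/eqP; rewrite -[_ == _]e].
Qed.

Lemma quot_proj_repr (x : quot_mod) : quot_proj (repr x) = x.
Proof. exact: reprK. Qed.

Lemma quot_projD u v : quot_proj (u + v) = quot_proj u + quot_proj v.
Proof. exact: (raddfD (\pi_(Quotient.quot sub_zmodClosed))). Qed.

Definition quot_scale (k : R) (x : quot_mod) := quot_proj (k *: repr x).

Lemma quot_projZ k v : quot_proj (k *: v) = quot_scale k (quot_proj v).
Proof.
apply/quot_projP; rewrite -scalerBr.
apply: GRing.subsemimod_closedZ (GRing.submod_closed_semi Wsub) _ _ _.
by apply/quot_projP; rewrite quot_proj_repr.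
Qed.

Fact quot_scalerA a b x : quot_scale a (quot_scale b x) = quot_scale (a * b) x.
Proof. by rewrite -(quot_proj_repr x) -!quot_projZ scalerA. Qed.

Fact quot_scale1r : left_id 1 quot_scale.
Proof. by move=> x; rewrite /quot_scale scale1r quot_proj_repr. Qed.

Fact quot_scalerDr : right_distributive quot_scale +%R.
Proof.
move=> a x y; rewrite -(quot_proj_repr x) -(quot_proj_repr y).
by rewrite -quot_projD -!quot_projZ scalerDr quot_projD.
Qed.

Fact quot_scalerDl x : {morph quot_scale^~ x : a b / a + b}.
Proof.
move=> a b; rewrite -(quot_proj_repr x).
by rewrite -!quot_projZ scalerDl quot_projD.
Qed.

HB.instance Definition _ := GRing.Zmodule_isLmodule.Build R quot_mod
  quot_scalerA quot_scale1r quot_scalerDr quot_scalerDl.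

Fact quot_proj_is_linear : linear quot_proj.
Proof. by move=> k u v; rewrite quot_projD quot_projZ. Qed.

HB.instance Definition _ :=
  GRing.isLinear.Build R V quot_mod *:%R quot_proj quot_proj_is_linear.

End QuotientModule.

(* Ideals are required to be proper for the quotients to be algType's, which
   are nonzero rings. *)
Section Ideals.
Variables (K : fieldType) (A : algType K).

Definition two_sided_ideal (J : A -> Prop) : Prop :=
  [/\ J 0, forall x y, J x -> J y -> J (x + y)
    & forall a x b, J x -> J (a * x * b)].

Definition gen_ideal (G : A -> Prop) (x : A) : Prop :=
  forall J, two_sided_ideal J -> (forall g, G g -> J g) -> J x.

Lemma gen_ideal_two_sided G : two_sided_ideal (gen_ideal G).
Proof.
split=> [J JI _|x y Jx Jy J JI GJ|a x b Jx J JI GJ].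
- by case: JI.
- by case: (JI) => _ JD _; apply: JD; [exact: Jx JI GJ | exact: Jy JI GJ].
- by case: (JI) => _ _ JM; apply: JM; exact: Jx JI GJ.
Qed.

Lemma gen_idealS G g : G g -> gen_ideal G g.
Proof. by move=> Gg J _; apply. Qed.

Record prop_ideal := PropIdeal {
  ideal_set :> A -> Prop;
  prop_ideal_two_sided : two_sided_ideal ideal_set;
  prop_ideal_proper : ~ ideal_set 1 }.

Variable I : prop_ideal.

Definition in_ideal (x : A) : bool := `[< I x >].

Fact in_ideal_submod : submod_closed in_ideal.
Proof.
case: (prop_ideal_two_sided I) => I0 ID IM; split; first exact/asboolP.
move=> k x y /asboolP Ix /asboolP Iy; apply/asboolP/ID => //.
by have := IM k%:A x 1 Ix; rewrite mulr1 mulr_algl.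
Qed.

Definition quot_alg : Type := quot_mod in_ideal_submod.
HB.instance Definition _ := GRing.Lmodule.on quot_alg.

Definition alg_proj (x : A) : quot_alg := quot_proj in_ideal_submod x.

Lemma alg_projP x y : alg_proj x = alg_proj y <-> I (x - y).
Proof. by split=> [/quot_projP/asboolP|h]; last exact/quot_projP/asboolP. Qed.

Lemma alg_proj_repr (x : quot_alg) : alg_proj (repr x) = x.
Proof. exact: quot_proj_repr. Qed.

Definition qmul (x y : quot_alg) : quot_alg := alg_proj (repr x * repr y).

Lemma alg_projM x y : alg_proj (x * y) = qmul (alg_proj x) (alg_proj y).
Proof.
apply/quot_projP.
set x' := repr _; set y' := repr _.
have -> : x * y - x' * y' = 1 * (x - x') * y + x' * (y - y') * 1.
  by rewrite mul1r mulr1 mulrBl mulrBr addrA subrK.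
apply/asboolP; case: (prop_ideal_two_sided I) => _ ID IM.
by apply: ID; apply: IM; apply/alg_projP; rewrite alg_proj_repr.
Qed.

Lemma alg_projD x y : alg_proj (x + y) = alg_proj x + alg_proj y.
Proof. exact: quot_projD. Qed.

Fact qmulA : associative qmul.
Proof.
move=> x y z; rewrite -(alg_proj_repr x) -(alg_proj_repr y) -(alg_proj_repr z).
by rewrite -!alg_projM mulrA.
Qed.

Fact qmul1 : left_id (alg_proj 1) qmul.
Proof. by move=> x; rewrite -(alg_proj_repr x) -alg_projM mul1r. Qed.

Fact qmulr1 : right_id (alg_proj 1) qmul.
Proof. by move=> x; rewrite -(alg_proj_repr x) -alg_projM mulr1. Qed.

Fact qmulDl : left_distributive qmul +%R.
Proof.
move=> x y z; rewrite -(alg_proj_repr x) -(alg_proj_repr y) -(alg_proj_repr z).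
by rewrite -alg_projD -!alg_projM mulrDl alg_projD.
Qed.

Fact qmulDr : right_distributive qmul +%R.
Proof.
move=> x y z; rewrite -(alg_proj_repr x) -(alg_proj_repr y) -(alg_proj_repr z).
by rewrite -alg_projD -!alg_projM mulrDr alg_projD.
Qed.

Fact qone_neq0 : alg_proj 1 != 0.
Proof.
apply/eqP; have -> : 0 = alg_proj 0 by rewrite /alg_proj linear0.
by move/alg_projP; rewrite subr0; apply: prop_ideal_proper.
Qed.

Fact qscaleAl k x y : k *: qmul x y = qmul (k *: x) y.
Proof.
rewrite -(alg_proj_repr x) -(alg_proj_repr y) -alg_projM.
by rewrite /alg_proj -!linearZ -!/(alg_proj _) -alg_projM scalerAl.
Qed.

Fact qscaleAr k x y : k *: qmul x y = qmul x (k *: y).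
Proof.
rewrite -(alg_proj_repr x) -(alg_proj_repr y) -alg_projM.
by rewrite /alg_proj -!linearZ -!/(alg_proj _) -alg_projM scalerAr.
Qed.

HB.instance Definition _ := GRing.Zmodule_isNzRing.Build quot_alg
  qmulA qmul1 qmulr1 qmulDl qmulDr qone_neq0.
HB.instance Definition _ := GRing.Lmodule_isLalgebra.Build K quot_alg qscaleAl.
HB.instance Definition _ := GRing.Lalgebra_isAlgebra.Build K quot_alg qscaleAr.

End Ideals.

(* The algebra of the multiplicative monoid of R; the addition of R plays no
   role. *)
Section MonoidAlgebra.
Variables (K : fieldType) (R : nzRingType).

Definition monoid_mul (p q : R) : {malg K[R]} := << p * q >>.

Fact monoid_mulA p q r : bilext monoid_mul (monoid_mul p q) << r >> =
  bilext monoid_mul << p >> (monoid_mul q r).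
Proof. by rewrite !bilextU /monoid_mul mulrA. Qed.

Fact monoid_mul1 p : bilext monoid_mul << 1%R >> << p >> = << p >>.
Proof. by rewrite bilextU /monoid_mul mul1r. Qed.

Fact monoid_mulr1 p : bilext monoid_mul << p >> << 1%R >> = << p >>.
Proof. by rewrite bilextU /monoid_mul mulr1. Qed.

Fact monoid_one_neq0 : (<< 1%R : R >> : {malg K[R]}) != 0.
Proof. by rewrite monalgU_eq0 oner_eq0. Qed.

Definition monoid_table :=
  MulTable monoid_mulA monoid_mul1 monoid_mulr1 monoid_one_neq0.

Definition monoid_algebra := basis_alg monoid_table.
HB.instance Definition _ := GRing.Algebra.on monoid_algebra.

Definition monoid_elt (p : R) : monoid_algebra := << p >>.

End MonoidAlgebra.

(* The enveloping algebra A^op (x)_K A.  The tensor product is the quotient of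
   the free vector space on A^op * A by the span of the bilinearity relations.
   That free vector space is the algebra of the multiplicative monoid
   A^op * A, in which the span of the bilinearity relations is already the
   two-sided ideal they generate.  A^c is the opposite ring of A. *)
Section Enveloping.
Variables (K : fieldType) (A : algType K).

Local Notation F := (monoid_algebra K (A^c * A)%type).

Definition ptensor (a : A) (b : A) : F := @monoid_elt K (A^c * A)%type (a, b).

Inductive bilinear_rel : F -> Prop :=
| BilinDl a a' b : bilinear_rel (ptensor (a + a') b - ptensor a b - ptensor a' b)
| BilinDr a b b' : bilinear_rel (ptensor a (b + b') - ptensor a b - ptensor a b')
| BilinZl (k : K) a b : bilinear_rel (ptensor (k *: a) b - k *: ptensor a b)
| BilinZr (k : K) a b : bilinear_rel (ptensor a (k *: b) - k *: ptensor a b).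

(* The left module structure of A over A^op (x) A: (a (x) b) . x = b x a. *)
Definition env_act (u : F) (x : A) : A :=
  lext (fun p : A^c * A => p.2 * x * (p.1 : A)) u.

Lemma env_actU a b x : env_act (ptensor a b) x = b * x * a.
Proof. exact: lextU. Qed.

Lemma env_act_linearl x : linear (env_act ^~ x).
Proof. by move=> k u v; rewrite /env_act linearP. Qed.

Lemma env_act_linearr u : linear (env_act u).
Proof.
move=> k x y; rewrite /env_act /lext scaler_sumr -big_split /=.
apply: eq_bigr => p _.
rewrite mulrDr mulrDl scalerDr; congr (_ + _).
by rewrite -scalerAr -scalerAl !scalerA mulrC.
Qed.

Lemma env_actM u v x : env_act (u * v) x = env_act u (env_act v x).
Proof.
move: u; apply: malg_linP => [k u u'|k u u'|[a b]].
- by rewrite mulrDl -scalerAl env_act_linearl.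
- by rewrite env_act_linearl.
move: v; apply: malg_linP => [k v v'|k v v'|[a' b']].
- by rewrite mulrDr -scalerAr env_act_linearl.
- by rewrite env_act_linearl env_act_linearr.
rewrite (basis_algM (monoid_table K _)).
by rewrite [LHS]lextU [in RHS]/env_act lextU [in RHS]lextU /= !mulrA.
Qed.

Lemma env_act1 x : env_act 1 x = x.
Proof. by rewrite [LHS]lextU /= mul1r mulr1. Qed.

Lemma env_actD u v x : env_act (u + v) x = env_act u x + env_act v x.
Proof. exact: (linearD (@lext _ _ _ _)). Qed.

Lemma env_actB u v x : env_act (u - v) x = env_act u x - env_act v x.
Proof. exact: (linearB (@lext _ _ _ _)). Qed.

Lemma env_actZ k u x : env_act (k *: u) x = k *: env_act u x.
Proof. exact: (linearZ_LR (@lext _ _ _ _)). Qed.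

Lemma env_act_bilinear u x : bilinear_rel u -> env_act u x = 0.
Proof.
have tU := env_actU.
case=> [a a' b|a b b'|k a b|k a b]; rewrite ?env_actB ?env_actZ;
  move: ptensor tU => T tU; rewrite !tU.
- by rewrite mulrDr addrAC addrK subrr.
- by rewrite !mulrDl addrAC addrK subrr.
- by rewrite -scalerAr subrr.
- by rewrite -!scalerAl subrr.
Qed.

Lemma env_act_ideal u x : gen_ideal bilinear_rel u -> env_act u x = 0.
Proof.
move=> Ju; move: x.
apply: (Ju (fun v => forall x, env_act v x = 0)) => [|v rv x]; last first.
  exact: env_act_bilinear.
have a0 v : env_act v 0 = 0.
  have := env_act_linearr v (-1) 0 0.
  by rewrite scaler0 addr0 scaleN1r addNr.
split=> [x|v w v0 w0 x|v w v' w0 x].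
- by rewrite /env_act linear0.
- by rewrite env_actD v0 w0 addr0.
- by rewrite !env_actM w0 a0.
Qed.

Fact env_ideal_proper : ~ gen_ideal bilinear_rel 1.
Proof.
move=> h; have := env_act_ideal 1 h.
by rewrite env_act1 => /eqP; rewrite oner_eq0.
Qed.

Definition env_ideal :=
  PropIdeal (gen_ideal_two_sided bilinear_rel) env_ideal_proper.

Definition enveloping := quot_alg env_ideal.
HB.instance Definition _ := GRing.Algebra.on enveloping.

Definition tensor (a b : A) : enveloping := alg_proj env_ideal (ptensor a b).

Definition regular_bimodule : Type := A.
HB.instance Definition _ := GRing.Zmodule.on regular_bimodule.

Definition bimod_scale (t : enveloping) (x : regular_bimodule)
  : regular_bimodule := env_act (repr t) x.

Lemma bimod_scaleE u x : bimod_scale (alg_proj env_ideal u) x = env_act u x.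
Proof.
have /alg_projP h := alg_proj_repr (alg_proj env_ideal u).
have := env_act_ideal x h.
by rewrite env_actB => /eqP; rewrite subr_eq0 => /eqP.
Qed.

Fact bimod_scalerA s t x :
  bimod_scale s (bimod_scale t x) = bimod_scale (s * t) x.
Proof.
rewrite -(alg_proj_repr s) -(alg_proj_repr t) -[_ * _]alg_projM.
by rewrite !bimod_scaleE env_actM.
Qed.

Fact bimod_scale1r : left_id 1 bimod_scale.
Proof. by move=> x; rewrite bimod_scaleE env_act1. Qed.

Fact bimod_scalerDr : right_distributive bimod_scale +%R.
Proof.
move=> t x y; rewrite /bimod_scale.
by have := env_act_linearr (repr t) 1 x y; rewrite !scale1r.
Qed.

Fact bimod_scalerDl x : {morph bimod_scale^~ x : s t / s + t}.
Proof.
move=> s t; rewrite -(alg_proj_repr s) -(alg_proj_repr t) -alg_projD.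
by rewrite !bimod_scaleE env_actD.
Qed.

HB.instance Definition _ := GRing.Zmodule_isLmodule.Build enveloping
  regular_bimodule bimod_scalerA bimod_scale1r bimod_scalerDr bimod_scalerDl.

Lemma bimod_tensorE a b (x : A) : tensor a b *: (x : regular_bimodule) = b * x * a.
Proof. by rewrite [LHS]bimod_scaleE env_actU. Qed.

End Enveloping.

Section Resolutions.
Variable E : nzRingType.

Definition projective (P : lmodType E) : Prop :=
  forall (M N : lmodType E) (g : {linear M -> N}) (f : {linear P -> N}),
    (forall y, exists x, g x = y) ->
  exists h : {linear P -> M}, forall x, g (h x) = f x.

Record proj_resolution (M : lmodType E) := ProjResolution {
  res_mod :> nat -> lmodType E;
  res_diff : forall n, {linear res_mod n.+1 -> res_mod n};
  res_aug : {linear res_mod 0 -> M};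
  res_projective : forall n, projective (res_mod n);
  res_aug_surj : forall m, exists x, res_aug x = m;
  res_exact0 : forall x, res_aug x = 0 <-> exists y, res_diff 0 y = x;
  res_exact : forall n x,
    res_diff n x = 0 <-> exists y, res_diff n.+1 y = x }.

Definition free_mod (X : choiceType) : lmodType E := {malg E[X]}.

Lemma free_mod_projective X : projective (free_mod X).
Proof.
move=> M N g f gS.
have [h hE] := choice (fun x : X => gS (f << x >>)).
exists (lext h : {linear _ -> _}).
apply: malg_linP => [k u v|k u v|x]; rewrite ?linearP //.
by rewrite -hE; congr (g _); apply: lextU.
Qed.

Definition free_cover (M : lmodType E) : {linear free_mod M -> M} :=
  lext (fun m : M => m).

Lemma free_cover_surj (M : lmodType E) (m : M) : exists x, free_cover M x = m.
Proof. by exists << m >>; apply: lextU. Qed.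

Definition in_kernel (M N : lmodType E) (f : {linear M -> N}) : pred M :=
  fun x => f x == 0.

Fact in_kernel_submod (M N : lmodType E) (f : {linear M -> N}) :
  submod_closed (in_kernel f).
Proof.
split=> [|a x y kx ky]; first exact/eqP/linear0.
have fx : f x = 0 by apply/eqP.
have fy : f y = 0 by apply/eqP.
by apply/eqP; rewrite linearP fx fy scaler0 addr0.
Qed.

HB.instance Definition _ (M N : lmodType E) (f : {linear M -> N}) :=
  GRing.isSubmodClosed.Build E M (in_kernel f) (in_kernel_submod f).

Definition kernel (M N : lmodType E) (f : {linear M -> N}) : Type :=
  {x : M | in_kernel f x}.

HB.instance Definition _ (M N : lmodType E) (f : {linear M -> N}) :=
  SubChoice.on (kernel f).
HB.instance Definition _ (M N : lmodType E) (f : {linear M -> N}) :=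
  [SubChoice_isSubLmodule of kernel f by <:].

Definition syzygy (M : lmodType E) : lmodType E := kernel (free_cover M).

(* The n-th term is free on the underlying set of the n-th syzygy of M. *)
Section FreeResolution.
Variable M : lmodType E.

Definition free_res_mod (n : nat) : lmodType E := free_mod (iter n syzygy M).

Definition free_res_diff (n : nat) :
    {linear free_res_mod n.+1 -> free_res_mod n} :=
  (val : kernel _ -> _) \o free_cover (syzygy (iter n syzygy M)).

Lemma free_res_diffE n x : (exists y, free_res_diff n y = x) <->
  free_cover (iter n syzygy M) x = 0.
Proof.
split=> [[y <-]|x0]; first exact/eqP/(valP (free_cover _ y)).
have kx : in_kernel (free_cover (iter n syzygy M)) x by apply/eqP.
have [y yE] := free_cover_surj (exist _ x kx : syzygy (iter n syzygy M)).
by exists y; rewrite /= yE.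
Qed.

Fact free_res_exact n x :
  free_res_diff n x = 0 <-> exists y, free_res_diff n.+1 y = x.
Proof.
rewrite free_res_diffE; split=> [dx0|cx0]; first by apply: val_inj.
by rewrite -[LHS]/(val (free_cover _ x)) cx0.
Qed.

Definition free_resolution : proj_resolution M :=
  @ProjResolution M free_res_mod free_res_diff (free_cover M)
    (fun n => @free_mod_projective _) (@free_cover_surj M)
    (fun x => iff_sym (@free_res_diffE 0 x)) free_res_exact.

End FreeResolution.
End Resolutions.

(* For a K-algebra E and E-modules M and N, the vector spaces Hom_E(M, N) and
   Ext^n_E(M, N) over K, the latter from a projective resolution of M. *)
Section Ext.
Variables (K : fieldType) (E : algType K).

Definition restrict_scalars (N : lmodType E) : Type := N.

Section RestrictScalars.
Variable N : lmodType E.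
HB.instance Definition _ := GRing.Zmodule.on (restrict_scalars N).

Definition rscale (k : K) (x : restrict_scalars N) : restrict_scalars N :=
  (k%:A : E) *: (x : N).

Fact rscalerA a b x : rscale a (rscale b x) = rscale (a * b) x.
Proof. by rewrite /rscale scalerA -scalerAl mul1r scalerA. Qed.
Fact rscale1r : left_id 1 rscale.
Proof. by move=> x; rewrite /rscale !scale1r. Qed.
Fact rscalerDr : right_distributive rscale +%R.
Proof. by move=> a x y; rewrite /rscale scalerDr. Qed.
Fact rscalerDl x : {morph rscale^~ x : a b / a + b}.
Proof. by move=> a b; rewrite /rscale !scalerDl. Qed.

HB.instance Definition _ := GRing.Zmodule_isLmodule.Build K
  (restrict_scalars N) rscalerA rscale1r rscalerDr rscalerDl.
End RestrictScalars.

Section Hom.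
Variables (M N : lmodType E).

Definition is_hom (f : M -> restrict_scalars N) : bool :=
  `[< linear (f : M -> N) >].

Fact is_hom_submod : submod_closed is_hom.
Proof.
split=> [|a f g /asboolP lf /asboolP lg]; apply/asboolP => k x y.
  by rewrite scaler0 addr0.
have -> z : (a *: f + g) z = (a%:A : E) *: (f z : N) + g z by [].
rewrite lf lg !scalerDr !scalerA -scalerAl mul1r -scalerAr mulr1.
by rewrite addrACA.
Qed.

HB.instance Definition _ :=
  GRing.isSubmodClosed.Build K (M -> restrict_scalars N) is_hom is_hom_submod.

Definition hom : Type := {f : M -> restrict_scalars N | is_hom f}.
HB.instance Definition _ := SubChoice.on hom.
HB.instance Definition _ := [SubChoice_isSubLmodule of hom by <:].

Definition hom_fun (f : hom) : M -> N := val f.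

End Hom.

Section ExtGroup.
Variables (M N : lmodType E) (P : proj_resolution M).

Definition is_cocycle n (f : hom (P n) N) : bool :=
  `[< forall y, hom_fun f (res_diff P n y) = 0 >].

Definition is_coboundary n : hom (P n) N -> Prop :=
  match n with
  | 0 => fun f => f = 0
  | n'.+1 => fun f => exists g : hom (P n') N,
      forall x, hom_fun f x = hom_fun g (res_diff P n' x)
  end.

Lemma hom_funP n a (f g : hom (P n) N) x :
  hom_fun (a *: f + g) x = (a%:A : E) *: hom_fun f x + hom_fun g x.
Proof. by rewrite /hom_fun linearP. Qed.

Fact is_cocycle_submod n : submod_closed (@is_cocycle n).
Proof.
split=> [|a f g /asboolP zf /asboolP zg]; apply/asboolP => y //.
by rewrite hom_funP zf zg scaler0 addr0.
Qed.

HB.instance Definition _ n := GRing.isSubmodClosed.Build K (hom (P n) N)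
  (@is_cocycle n) (is_cocycle_submod n).

Definition cocycles n : Type := {f : hom (P n) N | is_cocycle f}.
HB.instance Definition _ n := SubChoice.on (cocycles n).
HB.instance Definition _ n := [SubChoice_isSubLmodule of cocycles n by <:].

Definition coboundaries n : pred (cocycles n) :=
  fun f => `[< is_coboundary (val f) >].

Fact coboundaries_submod n : submod_closed (@coboundaries n).
Proof.
split=> [|a f g /asboolP bf /asboolP bg]; apply/asboolP.
  by case: n => [|n] //=; exists 0.
case: n f g bf bg => [|n] f g.
  move=> f0 g0; change (val (a *: f + g) = 0).
  rewrite -[val (a *: f + g)]/(a *: val f + val g) f0 g0.
  by rewrite scaler0 addr0.
move=> [u fu] [v gv]; exists (a *: u + v) => x.
change (hom_fun (val (a *: f + g)) x = hom_fun (a *: u + v) (res_diff P n x)).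
by rewrite -[val (a *: f + g)]/(a *: val f + val g) !hom_funP fu gv.
Qed.

Definition Ext (n : nat) : lmodType K := quot_mod (@coboundaries_submod n).

End ExtGroup.
End Ext.

Definition HH (K : fieldType) (A : algType K) (n : nat) : lmodType K :=
  let AA : lmodType (enveloping A) := regular_bimodule A in
  Ext AA (free_resolution AA) n.

Definition has_dim (K : fieldType) (V : lmodType K) (d : nat) : Prop :=
  exists f : {linear V -> 'rV[K]_d}, bijective f.

(* The quiver Gamma_s.  Its vertices are the integers modulo s; since 'Z_s is
   the ring of integers modulo s only for s > 1, so is this definition. *)
Section Lambda.
Variables (K : fieldType) (s : nat).

Fact circular_subproof : (0 < #|'Z_s|)%N.
Proof. by rewrite card_ord. Qed.

(* The arrows (i, false) and (i, true) are a_i and b_i. *)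
Definition circular_quiver : quiver :=
  @Quiver 'Z_s ('Z_s * bool)%type (fun a => a.1) (fun a => a.1 + 1)
    circular_subproof.

Local Notation KG := (path_algebra K circular_quiver).

Definition arrow_elt (i : 'Z_s) (c : bool) : KG :=
  path_elt K (@arrow_path circular_quiver (i, c)).

Definition x_elt : KG := \sum_i arrow_elt i false.
Definition y_elt : KG := \sum_i arrow_elt i true.

Inductive Lambda_rel : KG -> Prop :=
| LambdaXX : Lambda_rel (x_elt * x_elt)
| LambdaXY : Lambda_rel (x_elt * y_elt + y_elt * x_elt)
| LambdaYY : Lambda_rel (y_elt * y_elt).

Lemma arrow_elt_trivial i c v : (arrow_elt i c)@_(trivial_path v) = 0.
Proof.
rewrite mcoeffU; case: eqP => // /(congr1 (fun p => size (val p).2)) //.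
Qed.

Fact Lambda_ideal_proper : ~ gen_ideal Lambda_rel 1.
Proof.
pose v : vertex circular_quiver := 0.
have x0 : x_elt@_(trivial_path v) = 0.
  by rewrite raddf_sum big1 // => i _; rewrite /= arrow_elt_trivial.
have y0 : y_elt@_(trivial_path v) = 0.
  by rewrite raddf_sum big1 // => i _; rewrite /= arrow_elt_trivial.
have z0 (u w : KG) : u@_(trivial_path v) = 0 -> (u * w)@_(trivial_path v) = 0.
  by move=> u0; rewrite mcoeff_trivialM u0 mul0r.
have D0 (u w : KG) : u@_(trivial_path v) = 0 -> w@_(trivial_path v) = 0 ->
    (u + w)@_(trivial_path v) = 0.
  by move=> u0 w0; rewrite mcoeffD u0 w0 addr0.
move=> /(_ (fun u => u@_(trivial_path v) = 0)) H.
suff : (1 : KG)@_(trivial_path v) = 0.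
  by rewrite mcoeff_path_one => /eqP; rewrite oner_eq0.
apply: H => [|_ []].
- split=> [||u w u' w0]; [exact: mcoeff0 | exact: D0 |].
  by apply: z0; rewrite mcoeff_trivialM w0 mulr0.
- exact: z0.
- exact: (D0 _ _ (z0 _ _ x0) (z0 _ _ y0)).
- exact: z0.
Qed.

Definition Lambda_ideal : prop_ideal KG :=
  PropIdeal (gen_ideal_two_sided Lambda_rel) Lambda_ideal_proper.

Definition Lambda : algType K := quot_alg Lambda_ideal.

End Lambda.

(* Main.v *)
Require Import Defs.
From HB Require Import structures.
From mathcomp Require Import all_boot all_order all_algebra.
From mathcomp Require Import ring_quotient finmap ssrAC boolp functions monalg.

Set Implicit Arguments.
Unset Strict Implicit.
Unset Printing Implicit Defensive.

Import GRing.Theory.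
Local Open Scope ring_scope.
Local Notation hom := Defs.hom.

(** Write e_i for the trivial paths.  The products e_k x^p y^q with exponents
    p, q in {0, 1} form a basis of Lambda_s, which is the exterior algebra on x
    and y spread over a cycle: x and y anticommute, square to zero and move the
    vertices by one.  Such an algebra is Koszul, and its minimal bimodule
    resolution is explicit.  The term of degree n is the sum, over the divided
    monomials x^(p) y^(q) with p + q = n, of copies of the bimodule
    sum_i A e_i (x) e_(i+n) A; the differential lowers p by x (x) 1 +- 1 (x) x
    and q by y (x) 1 +- 1 (x) y.  It is exact because the two one-variable
    complexes have contracting homotopies, which combine into a homotopy of
    right modules ([khomotopyP], [khomotopy0]).  Ext does not depend on the
    projective resolution ([Ext_independent]), so HH is the cohomology of the
    bimodule maps from this complex to the algebra A.

    Such a map in degree n is a family, indexed by p + q = n, of elements of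
    sum_i e_i A e_(i+n).  For n = m s + r with r < s this space has dimension
    s, 2 s, s for r = 0, 1, 2, and is zero for the other r: it is the span of
    the e_k, of the e_k x and e_k y, or of the e_k x y.  The cochain complex is
    therefore a sum of three-term complexes in degrees N, N + 1, N + 2 with
    N = m s, and every component of its differential is, up to sign, the
    operator T c k = c (k + 1) - (-1)^N c k on functions on the cycle.  Going
    once around the cycle multiplies a solution of T c = 0 by (-1)^(N s).  If
    this sign is 1 in K, that is if s or m is even or K has characteristic 2,
    then the kernel and the cokernel of T are lines, and the dimensions are
    N + 1, 2 N + 4, N + 3 ([Ext0_good], [Ext1_good], [Ext2_good]).  Otherwise
    T is bijective and everything vanishes. *)

(** * Ext from an arbitrary projective resolution *)

Definition mk_linear (R : pzRingType) (U V : lmodType R) (f : U -> V)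
  (fL : linear f) : {linear U -> V} :=
  HB.pack f (GRing.isLinear.Build R U V *:%R f fL).

Lemma has_dim_quot (K : fieldType) (V : lmodType K) (W : {pred V})
    (Wsub : submod_closed W) (d : nat) (phi : {linear V -> 'rV[K]_d}) :
  (forall v, phi v = 0 <-> v \in W) -> (forall t, exists v, phi v = t) ->
  has_dim (quot_mod Wsub) d.
Proof.
move=> kerE phiS.
have phi_eq u v : quot_proj Wsub u = quot_proj Wsub v -> phi u = phi v.
  by move/quot_projP/kerE => /eqP; rewrite linearB subr_eq0 => /eqP.
have phi_proj v : phi (repr (quot_proj Wsub v)) = phi v.
  by apply: phi_eq; rewrite quot_proj_repr.
pose f (X : quot_mod Wsub) := phi (repr X).
have fL : linear f.
  move=> k X Y; rewrite -(quot_proj_repr X) -(quot_proj_repr Y) -linearP.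
  by rewrite /f !phi_proj linearP.
exists (mk_linear fL).
have [g gE] := choice phiS.
exists (fun t => quot_proj Wsub (g t)) => [X|t] /=; last by rewrite /f phi_proj.
rewrite -[RHS]quot_proj_repr; apply/quot_projP/kerE.
by rewrite linearB gE subrr.
Qed.

Section Comparison.
Variable E : nzRingType.

(** The definition of projectivity only speaks of surjections; exactness at B
    turns g into a surjection onto the kernel of k, which also contains f. *)
Lemma projective_lift (P A B C : lmodType E) (f : {linear P -> B})
    (g : {linear A -> B}) (k : {linear B -> C}) :
  projective P -> (forall b, k b = 0 <-> exists a, g a = b) ->
  (forall p, k (f p) = 0) -> exists h : {linear P -> A}, forall p, g (h p) = f p.
Proof.
move=> Pproj exB kf0.
have kg a : in_kernel k (g a) by apply/eqP/exB; exists a.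
have kf p : in_kernel k (f p) by apply/eqP.
pose g1 a : kernel k := exist _ (g a) (kg a).
pose f1 p : kernel k := exist _ (f p) (kf p).
have g1L : linear g1 by move=> c u v; apply/val_inj; rewrite /= linearP.
have f1L : linear f1 by move=> c u v; apply/val_inj; rewrite /= linearP.
have [|h hE] := Pproj _ _ (mk_linear g1L) (mk_linear f1L).
  case=> b kb; have /exB[a ab] : k b = 0 by apply/eqP.
  by exists a; apply: val_inj.
by exists h => p; have /(congr1 val) := hE p.
Qed.

Variable M : lmodType E.
Implicit Types P Q : proj_resolution M.

Definition graded_map P Q := forall n, {linear P n -> Q n}.

Definition chain_map P Q (f : graded_map P Q) :=
  (forall x, res_aug Q (f 0 x) = res_aug P x) /\
  (forall n x, res_diff Q n (f n.+1 x) = f n (res_diff P n x)).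

Lemma res_diffK P n x : res_diff P n (res_diff P n.+1 x) = 0.
Proof. by apply/res_exact; exists x. Qed.

Lemma res_augK P x : res_aug P (res_diff P 0 x) = 0.
Proof. by apply/res_exact0; exists x. Qed.

Section ChainMapExists.
Variables P Q : proj_resolution M.

(** The state carried from degree to degree when a chain map is built: the next
    component can be lifted only because the previous square commutes. *)
Definition chain_square n := {fg : {linear P n -> Q n} * {linear P n.+1 -> Q n.+1} |
  forall x, res_diff Q n (fg.2 x) = fg.1 (res_diff P n x)}.

Lemma chain_square0 : exists t : chain_square 0,
  forall x, res_aug Q ((sval t).1 x) = res_aug P x.
Proof.
have [f fE] := @res_projective _ _ P 0 _ _ (res_aug Q) (res_aug P) (@res_aug_surj _ _ Q).
have [|g gE] := @projective_lift (P 1) (Q 1) (Q 0) M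
    (f \o res_diff P 0) (res_diff Q 0) (res_aug Q) (@res_projective _ _ P 1)
    (@res_exact0 _ _ Q).
  by move=> x /=; rewrite fE res_augK.
by exists (exist _ (f, g) gE).
Qed.

Lemma chain_squareS n (t : chain_square n) :
  exists t' : chain_square n.+1, (sval t').1 = (sval t).2.
Proof.
case: t => -[f g] /= fg.
have [|h hE] := @projective_lift (P n.+2) (Q n.+2) (Q n.+1) (Q n)
    (g \o res_diff P n.+1) (res_diff Q n.+1) (res_diff Q n)
    (@res_projective _ _ P n.+2) (@res_exact _ _ Q n).
  by move=> x /=; rewrite fg res_diffK linear0.
by exists (exist _ (g, h) hE).
Qed.

Lemma chain_map_exists : exists f : graded_map P Q, chain_map f.
Proof.
have [t0 t0E] := chain_square0.
pose next n t := sval (cid (@chain_squareS n t)).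
pose t := fix t n := if n is n'.+1 then next n' (t n') else t0.
have tS n : (sval (t n.+1)).1 = (sval (t n)).2 := svalP (cid (chain_squareS (t n))).
exists (fun n => (sval (t n)).1); split=> // n x.
by rewrite tS (svalP (t n)).
Qed.

End ChainMapExists.

(** The first clause is the invariant from which the next component is lifted.
    As it does not mention the components of lower degree, these need not be
    chosen coherently and an induction on existence statements is enough. *)
Lemma chain_homotopy P Q (f g : graded_map P Q) : chain_map f -> chain_map g ->
  forall n, exists s : {linear P n -> Q n.+1},
    (forall x, res_diff Q n (s (res_diff P n x)) =
      f n (res_diff P n x) - g n (res_diff P n x)) /\
    match n return {linear P n -> Q n.+1} -> Prop with
    | 0 => fun s => forall x, f 0 x - g 0 x = res_diff Q 0 (s x)
    | n'.+1 => fun s => exists r : {linear P n' -> Q n'.+1}, forall x,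
        f n'.+1 x - g n'.+1 x = res_diff Q n'.+1 (s x) + r (res_diff P n' x)
    end s.
Proof.
move=> [f0 fS] [g0 gS]; elim=> [|n [r [rE _]]].
  have [|s sE] := @projective_lift (P 0) (Q 1) (Q 0) M (f 0 \- g 0)
      (res_diff Q 0) (res_aug Q) (@res_projective _ _ P 0) (@res_exact0 _ _ Q).
    by move=> x; rewrite linearB f0 g0 subrr.
  by exists s; split=> x; rewrite sE.
have [|s sE] := @projective_lift (P n.+1) (Q n.+2) (Q n.+1) (Q n)
    (f n.+1 \- g n.+1 \- (r \o res_diff P n)) (res_diff Q n.+1)
    (res_diff Q n) (@res_projective _ _ P n.+1) (@res_exact _ _ Q n).
  by move=> x /=; rewrite !linearB /= fS gS rE subrr.
exists s; split=> [x|]; first by rewrite sE /= res_diffK linear0 subr0.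
by exists r => x; rewrite sE /= subrK.
Qed.

End Comparison.


Section ExtComparison.
Variables (K : fieldType) (E : algType K) (M N : lmodType E).
Implicit Types P Q : proj_resolution M.

Lemma hom_lin (U : lmodType E) (f : hom U N) : linear (hom_fun f).
Proof. by apply/asboolP; case: f. Qed.

Definition mk_hom (U : lmodType E) (f : U -> N) (fL : linear f) : hom U N :=
  exist _ (f : U -> restrict_scalars N) (introT (asboolP _) fL).

Lemma hom_inj (U : lmodType E) (f g : hom U N) :
  (forall x, hom_fun f x = hom_fun g x) -> f = g.
Proof. by move=> fg; apply/val_inj/funext. Qed.

Fact hom_comp_linear (U V : lmodType E) (h : {linear U -> V}) (z : hom V N) :
  linear (hom_fun z \o h).
Proof. by move=> k x y; rewrite /= linearP hom_lin. Qed.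

Definition hom_comp (U V : lmodType E) (h : {linear U -> V}) (z : hom V N) :
  hom U N := mk_hom (hom_comp_linear h z).

Lemma cocycleP P n (z : cocycles N P n) y :
  hom_fun (val z) (res_diff P n y) = 0.
Proof. by move: y; apply/asboolP; case: z. Qed.

Section Pullback.
Variables (P Q : proj_resolution M) (f : graded_map P Q).
Hypothesis fC : chain_map f.

Fact pullback_cocycle n (z : cocycles N Q n) :
  is_cocycle (hom_comp (f n) (val z)).
Proof.
by apply/asboolP => y; rewrite -[LHS]/(hom_fun _ (f n _)) -fC.2 cocycleP.
Qed.

Definition pullback n (z : cocycles N Q n) : cocycles N P n :=
  exist (fun g => is_cocycle g) (hom_comp (f n) (val z)) (pullback_cocycle z).

Lemma pullback_linear n : linear (@pullback n).
Proof. by move=> k u v; apply/val_inj/hom_inj. Qed.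

Lemma pullback_coboundary n (z : cocycles N Q n) :
  is_coboundary (val z) -> is_coboundary (val (pullback z)).
Proof.
case: n z => [z z0|n z [g zg]] /=; first by apply: hom_inj => x; rewrite -[LHS]/(hom_fun (val z) _) z0.
exists (hom_comp (f n) g) => x.
by rewrite -[LHS]/(hom_fun (val z) _) zg fC.2.
Qed.

End Pullback.

(** A chain endomap over the identity of M is homotopic to the identity. *)
Lemma homotopic_coboundary P (f : graded_map P P) : chain_map f ->
  forall n (z z' : cocycles N P n),
  (forall x, hom_fun (val z') x = hom_fun (val z) (f n x)) ->
  is_coboundary (val (z' - z)).
Proof.
move=> fC n z z' zz'.
have idC : chain_map (fun n => idfun : {linear P n -> P n}) by [].
have zB x y : hom_fun (val z) (x - y) = hom_fun (val z) x - hom_fun (val z) y.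
  by rewrite addrC -scaleN1r hom_lin scaleN1r addrC.
have vE x : hom_fun (val (z' - z)) x = hom_fun (val z) (f n x - x).
  by rewrite zB -zz'.
have [s [_]] := chain_homotopy fC idC n.
case: n z z' zz' zB vE s => [|n] z z' zz' zB vE s.
  by move=> sE; apply: hom_inj => x; rewrite vE [_ - _]sE cocycleP.
move=> [r rE]; exists (hom_comp r (val z)) => x.
rewrite vE [_ - _]rE -[res_diff _ _ _ in LHS]scale1r hom_lin cocycleP.
by rewrite scaler0 add0r.
Qed.

(** Chain maps in both directions exist over the identity of M, and both
    composites are homotopic to the identity; so pulling back along one of them
    is bijective on cohomology. *)
Lemma Ext_independent P Q n d :
  has_dim (Ext N P n) d -> has_dim (Ext N Q n) d.
Proof.
case=> F [G FK GK].
have [f fC] := chain_map_exists P Q.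
have [g gC] := chain_map_exists Q P.
have gfC : chain_map (fun n => g n \o f n : {linear P n -> P n}).
  by split=> [x|k x] /=; rewrite ?(gC.1, fC.1, gC.2, fC.2).
have fgC : chain_map (fun n => f n \o g n : {linear Q n -> Q n}).
  by split=> [x|k x] /=; rewrite ?(gC.1, fC.1, gC.2, fC.2).
pose W := @coboundaries_submod _ _ M N P n.
pose phi z := F (quot_proj W (pullback fC z)).
have phiL : linear phi by move=> k u v; rewrite /phi pullback_linear !linearP.
have F0 z : F (quot_proj W z) = 0 <-> is_coboundary (val z).
  split=> [Fz0|/asboolP bz].
    have /quot_projP : quot_proj W z = quot_proj W 0.
      by rewrite -[LHS]FK Fz0 -(linear0 F) FK linear0.
    by rewrite subr0 => /asboolP.
  have -> : quot_proj W z = 0.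
    by rewrite -(linear0 (quot_proj W)); apply/quot_projP; rewrite subr0.
  exact: linear0.
apply: (@has_dim_quot _ _ _ _ _ (mk_linear phiL)) => [z|t] /=.
  rewrite F0; split=> [/(pullback_coboundary gC) bz|/asboolP]; last exact: pullback_coboundary.
  apply/asboolP.
  have h := @homotopic_coboundary Q _ fgC n z (pullback gC (pullback fC z)) (fun=> erefl).
  have inW (c : cocycles N Q n) : is_coboundary (val c) ->
      c \in @coboundaries _ _ M N Q n by move=> ?; apply/asboolP.
  have [_ WB] := GRing.submod_closedB (@coboundaries_submod _ _ M N Q n).
  have := WB _ _ (inW _ bz) (inW _ h).
  by rewrite opprB addrC subrK => /asboolP.
exists (pullback gC (repr (G t))).
rewrite /phi -[RHS]GK; congr (F _).
rewrite -[RHS]quot_proj_repr; apply/quot_projP/asboolP.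
exact: (@homotopic_coboundary P _ gfC n (repr (G t))
  (pullback fC (pullback gC (repr (G t)))) (fun=> erefl)).
Qed.

Lemma has_dim_Ext P n d (phi : hom (P n) N -> 'rV[K]_d) : linear phi ->
  (forall z, is_cocycle z -> phi z = 0 <-> is_coboundary z) ->
  (forall u, exists2 z, is_cocycle z & phi z = u) -> has_dim (Ext N P n) d.
Proof.
move=> phiL phi0 phiS.
have phi'L : linear (fun z : cocycles N P n => phi (val z)).
  by move=> k u v; rewrite linearP phiL.
apply: (@has_dim_quot _ _ _ _ _ (mk_linear phi'L)) => [z|u] /=.
  by rewrite phi0; [split=> ?; apply/asboolP | exact: (valP z)].
by have [z zP <-] := phiS u; exists (exist (fun z => is_cocycle z) z zP).
Qed.

End ExtComparison.

(** * The enveloping algebra as a tensor product *)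

Lemma malg_lin0 (R : nzRingType) (B : choiceType) (V : lmodType R)
    (u : {malg R[B]} -> V) :
  linear u -> (forall b, u << b >> = 0) -> forall g, u g = 0.
Proof.
move=> uL u0; apply: malg_linP => // k g h.
by rewrite scaler0 addr0.
Qed.

(** The elements u with f (a * u * b) = 0 for all a and b form an ideal. *)
Lemma gen_ideal_ker (K : fieldType) (A : algType K) (G : A -> Prop)
    (V : lmodType K) (f : A -> V) : linear f ->
  (forall a g b, G g -> f (a * g * b) = 0) -> forall u, gen_ideal G u -> f u = 0.
Proof.
move=> fL; pose f' := mk_linear fL; rewrite -[f]/(f' : A -> V).
move=> fG u Gu; suff : forall a b, f' (a * u * b) = 0.
  by move/(_ 1 1); rewrite mul1r mulr1.
apply: (Gu (fun u => forall a b, f' (a * u * b) = 0)).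
  split=> [a b|g h g0 h0 a b|c g d g0 a b].
  - by rewrite mulr0 mul0r linear0.
  - by rewrite mulrDr mulrDl linearD g0 h0 addr0.
  - by rewrite !mulrA -mulrA; apply: g0.
by move=> g Gg a b; apply: fG.
Qed.

(** Additivity relations and homogeneity relations, taken together, give
    linearity in one variable. *)
Lemma gen_ideal_rel (K : fieldType) (A : algType K) (G : A -> Prop) (x y z w : A) :
  G (x - y - z) -> G (y - w) -> gen_ideal G (x - (w + z)).
Proof.
move=> Gxyz Gyw; have [_ ID _] := gen_ideal_two_sided G.
have -> : x - (w + z) = (x - y - z) + (y - w).
  by rewrite [x - y - z]addrAC addrA subrK -addrA -opprD [z + w]addrC.
by apply: ID => J _; apply.
Qed.

Lemma linear_sub3_eq0 (R : pzRingType) (U V : lmodType R) (f : U -> V) x y z a b c :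
  linear f -> f x = a -> f y = b -> f z = c -> a = b + c -> f (x - y - z) = 0.
Proof.
move=> fL fx fy fz abc; rewrite -[LHS]/(mk_linear fL _) !linearB /= fx fy fz abc.
by rewrite addrAC addrK subrr.
Qed.

Lemma linear_subZ_eq0 (R : pzRingType) (U V : lmodType R) (f : U -> V) k x y a b :
  linear f -> f x = a -> f y = b -> a = k *: b -> f (x - k *: y) = 0.
Proof.
move=> fL fx fy ab; rewrite -[LHS]/(mk_linear fL _) linearB linearZ /= fx fy ab.
by rewrite subrr.
Qed.

Definition bilinear_map (K : fieldType) (A E : algType K) (B : A -> A -> E) :=
  (forall b, linear (B^~ b)) /\ (forall a, linear (B a)).

(** A presentation of E as the tensor product of the opposite algebra of A with
    A by generators and a universal property, so that E itself stays abstract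
    in the construction of the resolution.  The first factor of [pure a b]
    acts on bimodules from the right and the second one from the left; [extend]
    and [pure_ind] are the existence and uniqueness of the linear map attached
    to a bilinear one. *)
Record tensor_presentation (K : fieldType) (A E : algType K) := TensorPresentation {
  pure : A -> A -> E;
  extend : (A -> A -> E) -> E -> E;
  pure_linearl : forall b, linear (pure^~ b);
  pure_linearr : forall a, linear (pure a);
  pureM : forall a b a' b', pure a b * pure a' b' = pure (a' * a) (b * b');
  pure11 : pure 1 1 = 1;
  pure_ind : forall u v : E -> E, linear u -> linear v ->
    (forall a b, u (pure a b) = v (pure a b)) -> u =1 v;
  extend_linear : forall B, bilinear_map B -> linear (extend B);
  extendE : forall B a b, bilinear_map B -> extend B (pure a b) = B a b }.

Section EnvelopingTensor.
Variables (K : fieldType) (A : algType K).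
Local Notation AA := (enveloping A).
Local Notation F := (monoid_algebra K (A^c * A)%type).

Lemma alg_proj_linear : linear (alg_proj (env_ideal A)).
Proof. by move=> k u v; rewrite /alg_proj linearP. Qed.

Lemma tensor_linearl b : linear (fun a : A => tensor a b : AA).
Proof.
move=> k a a'; rewrite /tensor -alg_proj_linear; apply/alg_projP.
exact: gen_ideal_rel (BilinDl (k *: a) a' b) (BilinZl k a b).
Qed.

Lemma tensor_linearr a : linear (fun b : A => tensor a b : AA).
Proof.
move=> k b b'; rewrite /tensor -alg_proj_linear; apply/alg_projP.
exact: gen_ideal_rel (BilinDr a (k *: b) b') (BilinZr k a b).
Qed.

Lemma ptensorM a b a' b' : (ptensor a b : F) * ptensor a' b' = ptensor (a' * a) (b * b').
Proof. exact: (basis_algM (monoid_table K _)). Qed.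

Lemma tensorM (a b a' b' : A) :
  tensor a b * tensor a' b' = tensor (a' * a) (b * b') :> AA.
Proof. by rewrite /tensor -[LHS]alg_projM ptensorM. Qed.

Lemma tensor_ind (V : lmodType K) (u v : AA -> V) : linear u -> linear v ->
  (forall a b, u (tensor a b) = v (tensor a b)) -> u =1 v.
Proof.
move=> uL vL uv t; rewrite -(alg_proj_repr t); move: (repr t : {malg K[_]}).
apply: malg_linP => [k f g|k f g|[a b]]; last exact: uv.
  by rewrite alg_proj_linear uL.
by rewrite alg_proj_linear vL.
Qed.

Lemma tensor11 : tensor 1 1 = 1 :> AA.
Proof.
rewrite -[LHS]mulr1; move: (1 : AA).
apply: tensor_ind => [k u v|//|a b]; first by rewrite mulrDr -scalerAr.
by rewrite tensorM mulr1 mul1r.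
Qed.

Section Lift.
Variables (V : lmodType K) (B : A -> A -> V).
Hypotheses (BL : forall b, linear (B ^~ b)) (BR : forall a, linear (B a)).

Let B' (p : A^c * A) : V := B p.1 p.2.

Let BDl x y z : B (x + y) z = B x z + B y z.
Proof. by rewrite -[x]scale1r BL !scale1r. Qed.

Let BDr x y z : B x (y + z) = B x y + B x z.
Proof. by rewrite -[y]scale1r BR !scale1r. Qed.

Let BZl k x y : B (k *: x) y = k *: B x y.
Proof.
have B0 : B 0 y = 0 by apply: (addrI (B 0 y)); rewrite -BDl !addr0.
by rewrite -[k *: x]addr0 BL B0 addr0.
Qed.

Let BZr k x y : B x (k *: y) = k *: B x y.
Proof.
have B0 : B x 0 = 0 by apply: (addrI (B x 0)); rewrite -BDr !addr0.
by rewrite -[k *: y]addr0 BR B0 addr0.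
Qed.

Let rel0 a1 a2 b1 b2 (f : F -> V) : linear f ->
  (forall x y, f (ptensor x y) = B (b1 * (x * a1)) (a2 * y * b2)) ->
  forall g, bilinear_rel g -> f g = 0.
Proof.
move=> fL fE g [x x' y|x y y'|k x y|k x y].
- apply: (linear_sub3_eq0 fL (fE _ _) (fE _ _) (fE _ _)).
  by rewrite mulrDl mulrDr BDl.
- apply: (linear_sub3_eq0 fL (fE _ _) (fE _ _) (fE _ _)).
  by rewrite mulrDr mulrDl BDr.
- apply: (linear_subZ_eq0 fL (fE _ _) (fE _ _)).
  by rewrite -scalerAl -scalerAr BZl.
- apply: (linear_subZ_eq0 fL (fE _ _) (fE _ _)).
  by rewrite -scalerAr -scalerAl BZr.
Qed.

Lemma lext_bilinear_rel u : gen_ideal (@bilinear_rel K A) u -> lext B' u = 0.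
Proof.
apply: (@gen_ideal_ker K F _ V (lext B' : F -> V)); first exact: lext_linear.
move=> a g b rg; move: a.
apply: (@malg_lin0 _ _ _ (fun a : F => lext B' (a * g * b))) => [k a a'|[a1 a2]].
  by rewrite !mulrDl -!scalerAl linearP.
move: b; apply: (@malg_lin0 _ _ _ (fun b : F => lext B' (_ * g * b))).
  by move=> k b b'; rewrite mulrDr -scalerAr linearP.
move=> [b1 b2].
pose f (z : F) := lext B' (ptensor a1 a2 * z * ptensor b1 b2 : F).
have fL : linear f.
  by move=> k z z'; rewrite /f mulrDr mulrDl -scalerAr -scalerAl linearP.
apply: (rel0 (a1 := a1) (a2 := a2) (b1 := b1) (b2 := b2) (f := f)) => // x y.
by rewrite /f !ptensorM; apply: lextU.
Qed.

Definition tensor_lift (t : AA) : V := lext B' (repr t).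

Lemma tensor_lift_proj u : tensor_lift (alg_proj (env_ideal A) u) = lext B' u.
Proof.
apply/eqP; rewrite -subr_eq0 -linearB; apply/eqP/lext_bilinear_rel.
by have /alg_projP := alg_proj_repr (alg_proj (env_ideal A) u); apply.
Qed.

Lemma tensor_lift_linear : linear tensor_lift.
Proof.
move=> k s t; rewrite -(alg_proj_repr s) -(alg_proj_repr t) -alg_proj_linear.
by rewrite !tensor_lift_proj linearP.
Qed.

Lemma tensor_liftE a b : tensor_lift (tensor a b) = B a b.
Proof. by rewrite tensor_lift_proj; apply: lextU. Qed.

End Lift.
Lemma enveloping_lift_linear (B : A -> A -> AA) :
  bilinear_map B -> linear (tensor_lift B).
Proof. by move=> [Bl Br]; apply: tensor_lift_linear. Qed.

Lemma enveloping_liftE (B : A -> A -> AA) a b :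
  bilinear_map B -> tensor_lift B (tensor a b) = B a b.
Proof. by move=> [Bl Br]; apply: tensor_liftE. Qed.

Definition enveloping_presentation : tensor_presentation A AA :=
  @TensorPresentation K A AA (@tensor K A) (@tensor_lift AA) tensor_linearl
    tensor_linearr tensorM tensor11 (@tensor_ind AA)
    enveloping_lift_linear enveloping_liftE.

End EnvelopingTensor.

(** * Algebras with a frame: coordinates on exterior monomials *)

Section Frame.
Variables (K : fieldType) (s : nat).

(** Coordinates on the basis e_k x^p y^q, with exponents p and q as booleans. *)
Definition frame_space := 'Z_s -> bool -> bool -> K^o.

(** The multiplication of A is recorded by its effect on coordinates.  The shifts
    k + 1 express e_k x = x e_(k+1), and the signs express y x = - x y. *)
Record exterior_frame (A : algType K) := ExteriorFrame {
  frx : A;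
  fry : A;
  fre : 'Z_s -> A;
  coord : A -> frame_space;
  of_coord : frame_space -> A;
  coord_linear : linear coord;
  coordK : cancel coord of_coord;
  of_coordK : cancel of_coord coord;
  coord1 : forall k p q, coord 1 k p q = (~~ p && ~~ q)%:R;
  coordxM : forall u k p q,
    coord (frx * u) k p q = if p then coord u (k + 1) false q else 0;
  coordyM : forall u k p q, coord (fry * u) k p q =
    if q then (-1) ^+ p * coord u (k + 1) p false else 0;
  coordMx : forall u k p q, coord (u * frx) k p q =
    if p then (-1) ^+ q * coord u k false q else 0;
  coordMy : forall u k p q,
    coord (u * fry) k p q = if q then coord u k p false else 0;
  coordeM : forall i u k p q,
    coord (fre i * u) k p q = if k == i then coord u k p q else 0;
  coordMe : forall i u k p q, coord (u * fre i) k p q =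
    if k + p%:R + q%:R == i then coord u k p q else 0 }.

Section FrameTheory.
Variables (A : algType K) (fr : exterior_frame A).
Local Notation x := (frx fr).
Local Notation y := (fry fr).
Local Notation e := (fre fr).
Local Notation co := (coord fr).

Lemma coordP u v : (forall k p q, co u k p q = co v k p q) -> u = v.
Proof.
move=> uv; apply: (can_inj (coordK fr)).
by apply/funext => k; apply/funext => p; apply/funext => q.
Qed.

HB.instance Definition _ := GRing.isLinear.Build K A frame_space *:%R
  (coord fr) (coord_linear fr).

Lemma coordD u v k p q : co (u + v) k p q = co u k p q + co v k p q.
Proof. by rewrite linearD. Qed.
Lemma coordN u k p q : co (- u) k p q = - co u k p q.
Proof. by rewrite linearN. Qed.
Lemma coordZ c u k p q : co (c *: u) k p q = c * co u k p q.
Proof. by rewrite linearZ. Qed.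
Lemma coord0 k p q : co 0 k p q = 0.
Proof. by rewrite linear0. Qed.

Lemma coord_sum (I : Type) (r : seq I) (P : pred I) (F : I -> A) k p q :
  co (\sum_(i <- r | P i) F i) k p q = \sum_(i <- r | P i) co (F i) k p q.
Proof.
by elim/big_rec2: _ => [|i a b _ IH]; rewrite ?coord0 // coordD IH.
Qed.

Definition coordE := (coordD, coordN, coordZ, coord0, coordxM, coordyM,
  coordMx, coordMy, coordeM, coordMe).

Lemma xx0 : x * x = 0.
Proof. by apply: coordP => k [] q; rewrite -[x * x]mulr1 -mulrA !coordE. Qed.
Lemma yy0 : y * y = 0.
Proof.
by apply: coordP => k p []; rewrite -[y * y]mulr1 -mulrA !coordE //= mulr0.
Qed.
Lemma xy_yx : y * x = - (x * y).
Proof.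
apply: coordP => k p q; rewrite -[x * y]mulr1 -[y * x]mulr1 -!mulrA !coordE.
by case: p q => [] [] /=; rewrite ?(mulr0, oppr0, expr0, expr1, mulN1r, mul1r).
Qed.

Lemma ex i : e i * x = x * e (i + 1).
Proof.
apply: coordP => k p q; rewrite -[x in LHS]mulr1 -[e (i + 1)]mulr1 !coordE.
by case: p; rewrite ?if_same //; rewrite (inj_eq (addIr _)).
Qed.
Lemma ey i : e i * y = y * e (i + 1).
Proof.
apply: coordP => k p q; rewrite -[y in LHS]mulr1 -[e (i + 1)]mulr1 !coordE.
by case: q; rewrite ?if_same //; rewrite (inj_eq (addIr _)); case: ifP; rewrite ?mulr0.
Qed.

Lemma ee i j : e i * e j = if i == j then e i else 0.
Proof.
apply: coordP => k p q; rewrite -[e j]mulr1 !coordE -[e i in RHS]mulr1.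
by rewrite !(fun_if (fun u => co u k p q)) !coordE; case: eqP => [->|_];
  [rewrite eq_sym; case: eqP | case: eqP => // ->; case: eqP].
Qed.

Lemma sum_e : \sum_i e i = 1.
Proof.
apply: coordP => k p q; rewrite coord_sum (bigD1 k) //= big1 ?addr0 => [|i ik].
  by rewrite -[e k]mulr1 coordeM eqxx.
by rewrite -[e i]mulr1 coordeM eq_sym (negPf ik).
Qed.

(** The last monomial is y x because right multiplications on the other tensor
    factor will produce it in this order. *)
Lemma e_expand k u : e k * u = e k * (co u k false false *: 1 +
  co u k true false *: x + co u k false true *: y - co u k true true *: (y * x)).
Proof.
apply: coordP => k' p q; rewrite coordeM; case: eqP => [->|k'k]; last first.
  by rewrite coordeM; case: eqP.
rewrite coordeM eqxx !(coordD, coordN, coordZ, coord1).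
have -> : co x k p q = (p && ~~ q)%:R.
  by rewrite -[x]mulr1 coordxM coord1; case: p.
have -> : co y k p q = (~~ p && q)%:R.
  by rewrite -[y]mulr1 coordyM coord1; case: p q => [] []; rewrite ?mulr0 ?mulr1.
have -> : co (y * x) k p q = - (p && q)%:R.
  rewrite -[y * x]mulr1 -mulrA coordyM coordxM coord1.
  by case: p q => [] [] /=; rewrite ?(mulr0, mulr1, oppr0, expr1).
by case: p q => [] [] /=; rewrite ?(mulr0, mulr1, mulrN, opprK, oppr0, addr0, add0r).
Qed.

(** Removal of a left variable: eta maps x to 1 and x y to - y, theta maps y to
    1 and kappa maps x y to 1, the other monomials being sent to 0.  The
    contracting homotopy of the resolution is assembled from these three maps,
    and [eta_x] to [kappa_y] are the identities that make it contract. *)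
Definition fr_eta u : A := of_coord fr
  (fun k p q => if p then 0 else (-1) ^+ q * co u k true q).
Definition fr_theta u : A := of_coord fr
  (fun k p q => if p || q then 0 else co u k false true).
Definition fr_kappa u : A := of_coord fr
  (fun k p q => if p || q then 0 else co u k true true).
Local Notation eta := fr_eta.
Local Notation theta := fr_theta.
Local Notation kappa := fr_kappa.

Lemma coord_eta u k p q :
  co (eta u) k p q = if p then 0 else (-1) ^+ q * co u k true q.
Proof. by rewrite of_coordK. Qed.
Lemma coord_theta u k p q :
  co (theta u) k p q = if p || q then 0 else co u k false true.
Proof. by rewrite of_coordK. Qed.
Lemma coord_kappa u k p q :
  co (kappa u) k p q = if p || q then 0 else co u k true true.
Proof. by rewrite of_coordK. Qed.
Definition coord_etaE := (coord_eta, coord_theta, coord_kappa).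

Lemma eta_linear : linear eta.
Proof.
move=> c u v; apply: coordP => k p q; rewrite !(coordE, coord_etaE).
by case: p; rewrite ?mulr0 ?addr0 // mulrDr mulrCA.
Qed.
Lemma theta_linear : linear theta.
Proof.
move=> c u v; apply: coordP => k p q; rewrite !(coordE, coord_etaE).
by case: ifP; rewrite ?mulr0 ?addr0.
Qed.
Lemma kappa_linear : linear kappa.
Proof.
move=> c u v; apply: coordP => k p q; rewrite !(coordE, coord_etaE).
by case: ifP; rewrite ?mulr0 ?addr0.
Qed.

Ltac by_coord := apply: coordP => k [] []; rewrite !(coordE, coord_etaE) /=
  ?(mulr0, mul0r, mulr1, mul1r, expr0, expr1, addr0, add0r, oppr0, mulN1r,
    opprK, addNr, subrr).

Lemma eta_x u : eta (u * x) + eta u * x = u.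
Proof. by by_coord. Qed.
Lemma eta_y u : eta (u * y) + eta u * y = 0.
Proof. by by_coord. Qed.
Lemma theta_x u : theta (u * x) = 0.
Proof. by by_coord. Qed.
Lemma kappa_x u : kappa (u * x) = - theta u.
Proof. by by_coord. Qed.
Lemma unit_decomp u : eta u * x + theta u * y + theta (u * y) = u.
Proof. by by_coord. Qed.
Lemma kappa_y u : kappa (u * y) = eta u + kappa u * y.
Proof. by by_coord. Qed.
Lemma eta_e u i : eta (u * e (i + 1)) = eta u * e i.
Proof.
apply: coordP => k p q; rewrite !(coordE, coord_etaE) ; case: p => //=; rewrite ?if_same // addr0.
by rewrite addrAC (inj_eq (addIr _)); case: ifP; rewrite ?mulr0.
Qed.
Lemma theta_e u i : theta (u * e (i + 1)) = theta u * e i.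
Proof.
apply: coordP => k [] []; rewrite !(coordE, coord_etaE) //= ?if_same // !addr0.
by rewrite (inj_eq (addIr _)).
Qed.
Lemma kappa_e u i : kappa (u * e (i + 1 + 1)) = kappa u * e i.
Proof.
apply: coordP => k [] []; rewrite !(coordE, coord_etaE) //= ?if_same // !addr0.
by rewrite !(inj_eq (addIr _)).
Qed.
Lemma theta_eZ u k : theta u * e k = co u k false true *: e k.
Proof.
apply: coordP => k' [] []; rewrite -[e k in RHS]mulr1 !(coordE, coord_etaE, coord1) //= ?mulr0 ?if_same ?mulr0 // !addr0.
by case: eqP => [->|_]; rewrite ?mulr1 ?mulr0.
Qed.
Lemma kappa_eZ u k : kappa u * e k = co u k true true *: e k.
Proof.
apply: coordP => k' [] []; rewrite -[e k in RHS]mulr1 !(coordE, coord_etaE, coord1) //= ?mulr0 ?if_same ?mulr0 // !addr0.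
by case: eqP => [->|_]; rewrite ?mulr1 ?mulr0.
Qed.
End FrameTheory.
End Frame.

(** * The twisted difference operator on a cycle *)

Section CyclicDifference.
Variables (K : fieldType) (s : nat) (sgn : K).
Hypothesis s_gt1 : (1 < s)%N.
Implicit Type c : 'Z_s -> K.

(** All components of the cochain differential are copies of this operator. *)
Definition cdiff c k : K := c (k + 1) - sgn * c k.

(** The obstruction to solving [cdiff b = c]: started at b 0, the recursion for b
    arrives at sgn ^+ s * b 0 + csum c after one turn around the cycle. *)
Definition csum c : K := \sum_(k < s) sgn ^+ (s - k.+1) * c (k%:R).

Lemma cdiff_ker c : (forall k, cdiff c k = 0) ->
  forall j : nat, c j%:R = sgn ^+ j * c 0.
Proof.
move=> Tc; elim=> [|j IH]; first by rewrite mul1r.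
by rewrite -natr1; have /eqP := Tc j%:R; rewrite subr_eq0 IH exprS mulrA => /eqP.
Qed.

Lemma Zs_char : s%:R = 0 :> 'Z_s.
Proof. by apply: val_inj; rewrite /= val_Zp_nat // modnn. Qed.

(** The weighted terms telescope along one turn. *)
Lemma csum_cdiff c : csum (cdiff c) = (1 - sgn ^+ s) * c 0.
Proof.
pose G k := sgn ^+ (s - k) * c k%:R.
rewrite /csum (eq_bigr (fun k : 'I_s => G k.+1 - G k)) => [|k _].
  rewrite -(big_mkord xpredT (fun k => G k.+1 - G k)) telescope_sumr //.
  by rewrite /G subnn subn0 Zs_char mulr0n expr0 mulrBl.
rewrite /G -natr1 /cdiff mulrBr; congr (_ - _).
by rewrite mulrCA mulrA -exprS subnSK.
Qed.

Fixpoint csolve c b0 n : K :=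
  if n is n'.+1 then sgn * csolve c b0 n' + c n'%:R else b0.

Lemma csolveE c b0 n : csolve c b0 n =
  sgn ^+ n * b0 + \sum_(k < n) sgn ^+ (n - k.+1) * c k%:R.
Proof.
elim: n => [|n IH] /=; first by rewrite big_ord0 addr0 mul1r.
rewrite IH big_ord_recr /= subnn mul1r addrA mulrDr mulrA -exprS; congr (_ + _ + _).
rewrite mulr_sumr; apply: eq_bigr => k _.
by rewrite mulrA -exprS subSS -subSn.
Qed.

Lemma cdiff_solve c b0 : b0 = sgn ^+ s * b0 + csum c ->
  exists2 b : 'Z_s -> K, b 0 = b0 & forall k, cdiff b k = c k.
Proof.
move=> b0E; exists (fun k => csolve c b0 k) => // k; rewrite /cdiff.
have ks : (k < s)%N by rewrite -[s in (_ < s)%N](Zp_cast s_gt1).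
have kE : k = (k : nat)%:R by rewrite natr_Zp.
have [ks1|] := ltnP k.+1 s.
  have -> : nat_of_ord (k + 1) = k.+1.
    by rewrite kE natr1 val_Zp_nat // modn_small // -kE.
  by rewrite /= -kE addrC addKr.
move=> sk; have ksE : k.+1 = s by apply/eqP; rewrite eqn_leq ks sk.
(* The last vertex, where the hypothesis on b0 closes the cycle. *)
have -> : k + 1 = 0 by rewrite kE natr1 ksE Zs_char.
have -> : csolve c b0 (GRing.zero : 'Z_s) = csolve c b0 k.+1.
  by rewrite [LHS]/= ksE csolveE -b0E.
by rewrite /= -kE addrC addKr.
Qed.

Lemma csum_linear k c c' : csum (fun i => k * c i + c' i) = k * csum c + csum c'.
Proof.
rewrite /csum mulr_sumr -big_split; apply: eq_bigr => i _ /=.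
by rewrite mulrDr mulrCA.
Qed.

(** A function supported at the last vertex, which has weight 1 in [csum]. *)
Lemma csum_surj u : exists c, csum c = u.
Proof.
exists (fun k => if (k : nat) == s.-1 then u else 0).
have s1 : (s.-1 < s)%N by rewrite prednK // ltnW.
rewrite /csum (bigD1 (Ordinal s1)) //= big1 ?addr0 => [|i is1].
  by rewrite val_Zp_nat // modn_small // eqxx prednK ?subnn ?mul1r // ltnW.
rewrite val_Zp_nat // modn_small //; case: eqP => [e|_]; last by rewrite mulr0.
by case/eqP: is1; apply: val_inj.
Qed.

Lemma csum0_solve c : csum c = 0 -> exists b : 'Z_s -> K, forall k, cdiff b k = c k.
Proof.
move=> c0; have [|b _ bE] := @cdiff_solve c 0; last by exists b.
by rewrite c0 mulr0 addr0.
Qed.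

Section Trivial.
Hypothesis sgnS : sgn ^+ s = 1.

Lemma csum_cdiff0 c : csum (cdiff c) = 0.
Proof. by rewrite csum_cdiff sgnS subrr mul0r. Qed.

Lemma cdiff_ker_ex u : exists2 c : 'Z_s -> K, c 0 = u & forall k, cdiff c k = 0.
Proof.
apply: (@cdiff_solve (fun=> 0) u); rewrite sgnS mul1r /csum big1 ?addr0 // => k _.
by rewrite mulr0.
Qed.

End Trivial.

Lemma cdiff_ker0 c : (forall k, cdiff c k = 0) -> c 0 = 0 -> forall k, c k = 0.
Proof.
by move=> Tc c0 k; rewrite -[k]natr_Zp (cdiff_ker Tc) c0 mulr0.
Qed.

Section Nontrivial.
Hypotheses (sgnS : sgn ^+ s = -1) (two_neq0 : 2%:R != 0 :> K).

(** One turn around the cycle changes the sign of a solution. *)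
Lemma cdiff_inj c : (forall k, cdiff c k = 0) -> forall k, c k = 0.
Proof.
move=> Tc; apply: cdiff_ker0 => //; apply/eqP.
have /eqP := cdiff_ker Tc s; rewrite Zs_char sgnS mulN1r -subr_eq0 opprK.
by rewrite -mulr2n -mulr_natl mulf_eq0 (negPf two_neq0).
Qed.

(** Here b 0 = - b 0 + csum c can be solved for b 0. *)
Lemma cdiff_surj c : exists b : 'Z_s -> K, forall k, cdiff b k = c k.
Proof.
have [|b _ bE] := @cdiff_solve c (csum c / 2%:R); last by exists b.
rewrite sgnS mulN1r addrC; apply/eqP; rewrite eq_sym subr_eq -mulr2n -[_ / _ *+ 2]mulr_natl.
by rewrite mulrC divfK.
Qed.

End Nontrivial.

End CyclicDifference.

(** * The Koszul bimodule resolution *)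

Lemma cancel_pairs (V : zmodType) (a b c d : V) :
  a + b + (- c - d) + (- a + c + (- b + d)) = 0.
Proof.
rewrite [LHS](AC (2*2*(2*2)) ((1*5)*(2*7)*((3*6)*(4*8)))).
by rewrite /= !subrr !addNr !addr0.
Qed.

Lemma cancel_Th (V : zmodType) (a b d g h k l : V) :
  a + h + (d + k + (l + b)) + (g - l + (- h - k - b)) = a + d + g.
Proof.
rewrite [LHS](AC ((2*(2*2))*(2*(2*1))) ((1*3*7)*((2*9)*(4*10)*(5*8)*(6*11)))).
by rewrite /= !subrr !addr0.
Qed.

Lemma cancel_defect (V : zmodType) (a b c d g k l : V) :
  a - b + (c - d - (k - l)) = a + c + g - (g + (b + k) + d - l).
Proof.
rewrite !opprD !opprK !addrA [RHS](ACl (3*4*1*5*2*7*6*8)).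
by rewrite /= subrr add0r.
Qed.

Section Koszul.
Variables (K : fieldType) (s : nat) (A : algType K) (fr : exterior_frame s A).
Variables (E : algType K) (TP : tensor_presentation A E).

Local Notation t := (pure TP).
Local Notation x := (frx fr).
Local Notation y := (fry fr).
Local Notation e := (fre fr).
Local Notation XL := (t 1 x).
Local Notation XR := (t x 1).
Local Notation YL := (t 1 y).
Local Notation YR := (t y 1).

HB.instance Definition _ a := GRing.isLinear.Build K A E *:%R (t a) (pure_linearr TP a).

Definition tflip b a := t a b.
HB.instance Definition _ b := GRing.isLinear.Build K A E *:%R (tflip b) (pure_linearl TP b).
Lemma t0r a : t a 0 = 0. Proof. exact: linear0. Qed.
Lemma t0l b : t 0 b = 0. Proof. exact: (linear0 (tflip b)). Qed.
Lemma tNr a b : t a (- b) = - t a b. Proof. exact: linearN. Qed.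
Lemma tNl a b : t (- a) b = - t a b. Proof. exact: (linearN (tflip b)). Qed.
Lemma tDr a b c : t a (b + c) = t a b + t a c. Proof. exact: linearD. Qed.
Lemma tDl a b c : t (b + c) a = t b a + t c a. Proof. exact: (linearD (tflip a)). Qed.
Lemma tZr k a b : t a (k *: b) = k *: t a b. Proof. exact: linearZ_LR. Qed.
Lemma tZl k a b : t (k *: a) b = k *: t a b. Proof. exact: (linearZ_LR (tflip b)). Qed.

Lemma XLL : XL * XL = 0. Proof. by rewrite pureM xx0 t0r. Qed.
Lemma XRR : XR * XR = 0. Proof. by rewrite pureM xx0 t0l. Qed.
Lemma YLL : YL * YL = 0. Proof. by rewrite pureM yy0 t0r. Qed.
Lemma YRR : YR * YR = 0. Proof. by rewrite pureM yy0 t0l. Qed.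
Lemma XRL : XR * XL = XL * XR. Proof. by rewrite !pureM !mulr1 !mul1r. Qed.
Lemma YRL : YR * YL = YL * YR. Proof. by rewrite !pureM !mulr1 !mul1r. Qed.
Lemma YLXL : YL * XL = - (XL * YL). Proof. by rewrite !pureM xy_yx tNr !mulr1. Qed.
Lemma YRXR : YR * XR = - (XR * YR).
Proof. by rewrite !pureM xy_yx tNl opprK !mulr1. Qed.
Lemma YLXR : YL * XR = XR * YL. Proof. by rewrite !pureM !mulr1 !mul1r. Qed.
Lemma YRXL : YR * XL = XL * YR. Proof. by rewrite !pureM !mulr1 !mul1r. Qed.

Lemma t_suml (I : Type) (r : seq I) (P : pred I) (F : I -> A) b :
  t (\sum_(i <- r | P i) F i) b = \sum_(i <- r | P i) t (F i) b.
Proof. exact: (@raddf_sum _ _ (tflip b)). Qed.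

(** The bimodule sum_i A e_i (x) e_(i+d) A is the left ideal of E generated by
    this idempotent; hence bimodule maps from it to M are the elements of
    eps d *: M. *)
Definition eps (d : 'Z_s) : E := \sum_i t (e (i + d)) (e i).

Lemma eps_idem n : eps n * eps n = eps n.
Proof.
rewrite /eps mulr_suml; apply: eq_bigr => i _.
rewrite mulr_sumr (bigD1 i) //= big1 ?addr0 => [|j ji].
  by rewrite pureM !ee !eqxx.
by rewrite pureM !ee [i == j]eq_sym (negPf ji) t0r.
Qed.

Lemma sum_shift (F : 'Z_s -> E) : \sum_i F i = \sum_i F (i + 1).
Proof. by rewrite (reindex_inj (addIr 1)). Qed.

(** Moving x across the idempotent changes the distance between its vertices by
    one; so right multiplication by XL or XR maps E eps (d + 1) to E eps d. *)
Lemma epsXL d : eps (d + 1) * XL = XL * eps d.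
Proof.
rewrite /eps mulr_suml mulr_sumr [RHS]sum_shift; apply: eq_bigr => i _.
by rewrite !pureM ex mulr1 mul1r -addrA [1 + _]addrC.
Qed.
Lemma epsYL d : eps (d + 1) * YL = YL * eps d.
Proof.
rewrite /eps mulr_suml mulr_sumr [RHS]sum_shift; apply: eq_bigr => i _.
by rewrite !pureM ey mulr1 mul1r -addrA [1 + _]addrC.
Qed.
Lemma epsXR d : eps (d + 1) * XR = XR * eps d.
Proof.
rewrite /eps mulr_suml mulr_sumr; apply: eq_bigr => i _.
by rewrite !pureM ex mulr1 mul1r -addrA.
Qed.
Lemma epsYR d : eps (d + 1) * YR = YR * eps d.
Proof.
rewrite /eps mulr_suml mulr_sumr; apply: eq_bigr => i _.
by rewrite !pureM ey mulr1 mul1r -addrA.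
Qed.

(** Right multiplication by Dx n and Dy n gives the two components of the
    differential of the resolution. *)
Definition Dx n : E := XL + (-1) ^+ n *: XR.
Definition Dy n : E := YL + (-1) ^+ n *: YR.

Lemma epsDx n d : eps (d + 1) * Dx n = Dx n * eps d.
Proof. by rewrite mulrDr mulrDl -scalerAr -scalerAl epsXL epsXR. Qed.
Lemma epsDy n d : eps (d + 1) * Dy n = Dy n * eps d.
Proof. by rewrite mulrDr mulrDl -scalerAr -scalerAl epsYL epsYR. Qed.

Lemma DxDx n : Dx n.+1 * Dx n = 0.
Proof.
rewrite /Dx mulrDl !mulrDr -!scalerAl -!scalerAr XLL XRR XRL.
by rewrite !scaler0 addr0 add0r exprS mulN1r scaleNr subrr.
Qed.
Lemma DyDy n : Dy n.+1 * Dy n = 0.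
Proof.
rewrite /Dy mulrDl !mulrDr -!scalerAl -!scalerAr YLL YRR YRL.
by rewrite !scaler0 addr0 add0r exprS mulN1r scaleNr subrr.
Qed.
Lemma DxDy n : Dx n.+1 * Dy n + Dy n.+1 * Dx n = 0.
Proof.
rewrite /Dx /Dy !mulrDl !mulrDr -!scalerAl -!scalerAr YLXL YRXR YLXR YRXL.
rewrite exprS mulN1r !scaleNr !scalerN !opprK.
exact: cancel_pairs.
Qed.

Section OnSecondFactor.
Variables (g : A -> A) (gL : linear g).

Let B a b := t a (g b).
Let Bbil : bilinear_map B.
Proof.
split=> [b k u v|a k u v]; rewrite /B ?pure_linearl //.
by rewrite gL pure_linearr.
Qed.

(** The map on E induced by g on the factor that acts from the left.  It commutes
    with the multiplications on the other factor ([on_leftR]). *)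
Definition on_left : E -> E := extend TP B.
Lemma on_left_linear : linear on_left. Proof. exact: extend_linear. Qed.
Lemma on_leftE a b : on_left (t a b) = t a (g b). Proof. exact: (extendE TP _ _ Bbil). Qed.
HB.instance Definition _ := GRing.isLinear.Build K E E *:%R on_left on_left_linear.

Lemma on_leftR u a : on_left (u * t a 1) = on_left u * t a 1.
Proof.
move: u; apply: (@pure_ind _ _ _ TP) => [k u v|k u v|c b].
- by rewrite mulrDl -scalerAl linearP.
- by rewrite linearP mulrDl -scalerAl.
by rewrite pureM !on_leftE pureM !mulr1.
Qed.
End OnSecondFactor.

Lemma lin_id : linear (fun u : E => u). Proof. by []. Qed.
Lemma lin_add (f g : E -> E) : linear f -> linear g -> linear (fun u => f u + g u).
Proof. by move=> fL gL k u v; rewrite fL gL scalerDr addrACA. Qed.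
Lemma lin_opp (f : E -> E) : linear f -> linear (fun u => - f u).
Proof. by move=> fL k u v; rewrite fL opprD scalerN. Qed.
Lemma lin_mulr (f : E -> E) c : linear f -> linear (fun u => f u * c).
Proof. by move=> fL k u v; rewrite fL mulrDl -scalerAl. Qed.
Lemma lin_on_left g (gL : linear g) (f : E -> E) : linear f -> linear (fun u => on_left g (f u)).
Proof. by move=> fL k u v; rewrite fL on_left_linear. Qed.
Lemma lin_zero : linear (fun u : E => 0 : E).
Proof. by move=> k u v; rewrite scaler0 addr0. Qed.

(** Proves that both sides of an equality between endomaps of E are linear, and
    leaves its instance at pure tensors. *)
Ltac tensors u := move: u; apply: (@pure_ind _ _ _ TP); [ | | move=> c b;
   rewrite ?mulr_suml ?mulr_sumr ?(pureM, on_leftE (@eta_linear _ _ _ fr),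
     on_leftE (@theta_linear _ _ _ fr), on_leftE (@kappa_linear _ _ _ fr), mulr1, mul1r)];
   [ repeat first [exact: lin_id | exact: lin_zero | apply: lin_add | apply: lin_opp
     | apply: lin_mulr | apply: lin_on_left;
       [first [exact: eta_linear | exact: theta_linear | exact: kappa_linear]|]].. | ].

Local Notation H := (on_left (fr_eta fr)).
Local Notation Th := (on_left (fr_theta fr)).
Local Notation Kp := (on_left (fr_kappa fr)).

Lemma H_X u : H (u * XL) + H u * XL = u.
Proof. by tensors u; rewrite -tDr eta_x. Qed.
Lemma H_Y u : H (u * YL) + H u * YL = 0.
Proof. by tensors u; rewrite -tDr eta_y t0r. Qed.
Lemma Th_X u : Th (u * XL) = 0.
Proof. by tensors u; rewrite theta_x t0r. Qed.
Lemma Kp_X u : Kp (u * XL) = - Th u.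
Proof. by tensors u; rewrite kappa_x tNr. Qed.
Lemma unit_decompE u : H u * XL + Th u * YL + Th (u * YL) = u.
Proof. by tensors u; rewrite -!tDr unit_decomp. Qed.
Lemma Kp_Y u : Kp (u * YL) = H u + Kp u * YL.
Proof. by tensors u; rewrite kappa_y tDr. Qed.

Lemma on_left_sum g (gL : linear g) (F : 'Z_s -> E) :
  on_left g (\sum_i F i) = \sum_i on_left g (F i).
Proof. exact: (@raddf_sum _ _ (mk_linear (on_left_linear gL))). Qed.

Lemma on_left_eps g d : linear g -> (forall b i, g (b * e (i + 1)) = g b * e i) ->
  forall u, on_left g (u * eps d) = on_left g u * eps (d + 1).
Proof.
move=> gL ge u; move: u; apply: (@pure_ind _ _ _ TP) => [||c b].
- by apply: (lin_on_left gL); apply: lin_mulr.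
- by apply: lin_mulr; apply: (lin_on_left gL).
rewrite on_leftE // /eps !mulr_sumr sum_shift on_left_sum //; apply: eq_bigr => i _.
by rewrite !pureM on_leftE // ge -addrA [1 + _]addrC.
Qed.

Lemma H_eps d u : H (u * eps d) = H u * eps (d + 1).
Proof. by apply: on_left_eps; [exact: eta_linear | exact: eta_e]. Qed.
Lemma Th_eps d u : Th (u * eps d) = Th u * eps (d + 1).
Proof. by apply: on_left_eps; [exact: theta_linear | exact: theta_e]. Qed.
Lemma Kp_eps d u : Kp (u * eps d) = Kp u * eps (d + 1 + 1).
Proof.
move: u; apply: (@pure_ind _ _ _ TP) => [||c b].
- by apply: (lin_on_left (@kappa_linear _ _ _ fr)); apply: lin_mulr.
- by apply: lin_mulr; apply: (lin_on_left (@kappa_linear _ _ _ fr)).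
rewrite on_leftE; last exact: kappa_linear.
rewrite /eps !mulr_sumr sum_shift sum_shift on_left_sum; last exact: kappa_linear.
apply: eq_bigr => i _.
rewrite !pureM on_leftE ?kappa_e; last exact: kappa_linear.
by rewrite -!addrA [1 + (1 + _)]addrA [1 + 1 + _]addrC.
Qed.

(** The augmentation a (x) b |-> b a followed by its splitting
    a |-> sum_k (e_k a) (x) e_k, which is a map of right modules. *)
Let sigma_fun c b := \sum_k t (e k * b * c) (e k).
Let sigma_bilinear_map : bilinear_map sigma_fun.
Proof.
split=> [b k u v|c k u v]; rewrite /sigma_fun scaler_sumr -big_split /=;
  apply: eq_bigr => i _.
  by rewrite mulrDr -scalerAr tDl tZl.
by rewrite mulrDr mulrDl -scalerAr -scalerAl tDl tZl.
Qed.
Definition sigma := extend TP sigma_fun.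
Lemma sigma_linear : linear sigma. Proof. exact: extend_linear. Qed.
Lemma sigmaE c b : sigma (t c b) = \sum_k t (e k * b * c) (e k).
Proof. exact: extendE. Qed.

(** What is missing in degree 0 for the homotopy to contract ([H_defect]); by
    [defect_sigma] it factors through the augmentation. *)
Definition defect u := Th (u * YL) + Kp (u * YL) * XR + Th u * YR - Kp u * XR * YR.

Lemma defect_eps u : defect (u * eps 0) = defect u * eps 0.
Proof.
(* In degree 0 the idempotent has to move down, to distance - 1. *)
have epsYL0 : eps 0 * YL = YL * eps (-1) by rewrite -epsYL addNr.
rewrite /defect -[u * eps 0 * YL]mulrA epsYL0 mulrA !Th_eps !Kp_eps addNr.
rewrite -[_ * eps _ * XR]mulrA epsXR -[Th u * eps _ * YR]mulrA epsYR.
rewrite -[Kp u * eps _ * XR]mulrA epsXR -!mulrA epsYR !mulrA.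
by rewrite -!mulrDl -mulrBl.
Qed.

Lemma defect_linear : linear defect.
Proof.
rewrite /defect; do ![apply: lin_add | apply: lin_opp | apply: lin_mulr | exact: lin_id
 | apply: (lin_on_left (@theta_linear _ _ _ fr)) | apply: (lin_on_left (@kappa_linear _ _ _ fr))].
Qed.

Lemma defect_sigma u : u * eps 0 = u -> defect u = sigma u.
Proof.
move=> <-; rewrite defect_eps; move: u; apply: (@pure_ind _ _ _ TP) => [||c b].
- exact: lin_mulr defect_linear.
- by move=> k u v; rewrite mulrDl -scalerAl sigma_linear.
have -> : sigma (t c b * eps 0) = \sum_k t (e k * b * c) (e k).
  have sigS F : sigma (\sum_i F i) = \sum_(i : 'Z_s) sigma (F i).
    exact: (@raddf_sum _ _ (mk_linear sigma_linear)).
  rewrite /eps mulr_sumr sigS.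
  under eq_bigr => i _ do rewrite pureM sigmaE addr0.
  rewrite exchange_big /=; apply: eq_bigr => k _.
  rewrite -t_suml; congr (t _ _); rewrite -[b in RHS]mulr1 -(sum_e fr).
  rewrite !mulr_sumr mulr_suml; apply: eq_bigr => i _.
  by rewrite !mulrA -[_ * e i * e i]mulrA ee eqxx.
have cE : defect (t c b) = t c (fr_theta fr (b * y)) + t (x * c) (fr_kappa fr (b * y))
    + t (y * c) (fr_theta fr b) - t (y * x * c) (fr_kappa fr b).
  rewrite /defect !(pureM, on_leftE (@theta_linear _ _ _ fr), on_leftE (@kappa_linear _ _ _ fr)).
  by rewrite !mul1r !mulr1 !mulrA.
rewrite cE mulr_sumr; apply: eq_bigr => k _.
rewrite !mulrDl mulNr !pureM addr0 !theta_eZ !kappa_eZ !coordE /= !tZr -!tZl.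
rewrite -!tDl -tNl -tDl; congr (t _ _).
rewrite (e_expand fr k b) !mulrDr !mulrDl !mulrN !mulNr -!scalerAr -!scalerAl.
by rewrite !mulrA !mulr1.
Qed.

(** The generator indexed by (p, q) stands for the divided monomial x^(p) y^(q).
    Families indexed by all pairs and supported on p + q = n, rather than by
    p <= n alone, need no boundary cases in the differential. *)
Definition koszul_pred n (f : nat -> nat -> E^o) : bool := `[< forall p q,
  (f p q : E) * eps n%:R = f p q /\ ((p + q)%N != n -> f p q = 0) >].

Fact koszul_submod n : submod_closed (koszul_pred n).
Proof.
split=> [|c f g /asboolP fP /asboolP gP]; apply/asboolP => p q.
  by split=> //; apply: mul0r.
have [fe f0] := fP p q; have [ge g0] := gP p q.
split=> [|pqn]; last first.
  by rewrite -[LHS]/(c * (f p q : E) + g p q) f0 // g0 // mulr0 addr0.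
by rewrite -[(_ + _) p q]/(c * (f p q : E) + g p q) mulrDl -mulrA fe ge.
Qed.

HB.instance Definition _ n :=
  GRing.isSubmodClosed.Build E (nat -> nat -> E^o) (koszul_pred n) (koszul_submod n).

Definition koszul n : Type := {f : nat -> nat -> E^o | koszul_pred n f}.
HB.instance Definition _ n := SubChoice.on (koszul n).
HB.instance Definition _ n := [SubChoice_isSubLmodule of koszul n by <:].

Definition kcoef n (f : koszul n) p q : E := val f p q.

Lemma kcoef_eps n (f : koszul n) p q : kcoef f p q * eps n%:R = kcoef f p q.
Proof. by have /asboolP/(_ p q)[] := valP f. Qed.
Lemma kcoef0 n (f : koszul n) p q : (p + q)%N != n -> kcoef f p q = 0.
Proof. by have /asboolP/(_ p q)[_ h /h] := valP f. Qed.
Lemma koszulP n (f g : koszul n) : (forall p q, kcoef f p q = kcoef g p q) -> f = g.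
Proof.
by move=> fg; apply/val_inj/funext => p; apply/funext => q; apply: fg.
Qed.
Lemma kcoefP n c (f g : koszul n) p q :
  kcoef (c *: f + g) p q = c * kcoef f p q + kcoef g p q.
Proof. by rewrite /kcoef linearP. Qed.

Definition mk_koszul n (f : nat -> nat -> E) (fP : koszul_pred n f) : koszul n :=
  exist (fun g => koszul_pred n g) f fP.

Lemma kcoef_mk n f fP p q : kcoef (@mk_koszul n f fP) p q = f p q.
Proof. by []. Qed.

(** Only x^(p+1) y^(q) and x^(p) y^(q+1) contribute to x^(p) y^(q). *)
Definition kdfun n (f : koszul n.+1) p q : E :=
  kcoef f p.+1 q * Dx n.+1 + kcoef f p q.+1 * Dy n.+1.

Fact kdfunP n (f : koszul n.+1) : koszul_pred n (kdfun f).
Proof.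
apply/asboolP => p q; split; last first.
  by move=> pqn; rewrite /kdfun !kcoef0 ?mul0r ?addr0 ?addnS ?addSn ?eqSS.
rewrite mulrDl -!mulrA -epsDx -epsDy !mulrA.
by rewrite [n%:R + 1]natr1 !kcoef_eps.
Qed.

Definition kdiff n (f : koszul n.+1) : koszul n := mk_koszul (kdfunP f).

Lemma kdiff_linear n : linear (@kdiff n).
Proof.
move=> c f g; apply: koszulP => p q; rewrite kcoefP !kcoef_mk /kdfun !kcoefP.
by rewrite !mulrDl !mulrDr !mulrA addrACA.
Qed.
HB.instance Definition _ n := GRing.isLinear.Build E (koszul n.+1) (koszul n) *:%R
  (@kdiff n) (@kdiff_linear n).

Lemma kdiffK n (f : koszul n.+2) : kdiff (kdiff f) = 0.
Proof.
apply: koszulP => p q; rewrite !kcoef_mk /kdfun !kcoef_mk /kdfun.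
rewrite !mulrDl -!mulrA DxDx DyDy !mulr0 add0r addr0 -mulrDr.
by rewrite addrC DxDy mulr0.
Qed.

(** Writing [p, q] for the generator x^(p) y^(q), this is the map of right modules
    x [p, q] |-> [p + 1, q] and x y [p, q] |-> - y [p + 1, q], and for p = 0
    moreover y [0, q] |-> [0, q + 1], with the correction - (-1)^q [0, q + 1] x
    on x y [0, q] that the twist by right multiplications requires. *)
Definition khfun n (f : koszul n) p q : E :=
  match p, q with
  | p'.+1, _ => H (kcoef f p' q)
  | 0, q'.+1 => Th (kcoef f 0 q') - (-1) ^+ q' *: (Kp (kcoef f 0 q') * XR)
  | 0, 0 => 0
  end.

Lemma on_left0 g (gL : linear g) : on_left g 0 = 0.
Proof. exact: (linear0 (mk_linear (on_left_linear gL))). Qed.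

Fact khfunP n (f : koszul n) : koszul_pred n.+1 (khfun f).
Proof.
apply/asboolP => -[|p] [|q]; split; rewrite /khfun ?mul0r //.
- rewrite mulrBl -scalerAl -natr1 -mulrA -epsXR mulrA -Th_eps -Kp_eps.
  by rewrite kcoef_eps.
- move=> pqn; rewrite kcoef0 // !on_left0 ?mul0r ?scaler0 ?subr0 //.
    exact: kappa_linear. exact: theta_linear.
- by rewrite -natr1 -H_eps kcoef_eps.
- by move=> pqn; rewrite kcoef0 ?on_left0 //; exact: eta_linear.
- by rewrite -natr1 -H_eps kcoef_eps.
- by move=> pqn; rewrite kcoef0 ?on_left0 //; exact: eta_linear.
Qed.

Definition khomotopy n (f : koszul n) : koszul n.+1 := mk_koszul (khfunP f).

Lemma on_leftD g (gL : linear g) u v : on_left g (u + v) = on_left g u + on_left g v.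
Proof. exact: (raddfD (mk_linear (on_left_linear gL))). Qed.
Lemma on_leftDx g (gL : linear g) n u :
  on_left g (u * Dx n) = on_left g (u * XL) + (-1) ^+ n *: (on_left g u * XR).
Proof.
rewrite /Dx mulrDr -scalerAr on_leftD // -on_leftR //; congr (_ + _).
exact: (linearZ_LR (mk_linear (on_left_linear gL))).
Qed.
Lemma on_leftDy g (gL : linear g) n u :
  on_left g (u * Dy n) = on_left g (u * YL) + (-1) ^+ n *: (on_left g u * YR).
Proof.
rewrite /Dy mulrDr -scalerAr on_leftD // -on_leftR //; congr (_ + _).
exact: (linearZ_LR (mk_linear (on_left_linear gL))).
Qed.

Let etaL := @eta_linear _ _ _ fr.
Let thetaL := @theta_linear _ _ _ fr.
Let kappaL := @kappa_linear _ _ _ fr.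

(** The signs of the right multiplications in consecutive differentials are
    opposite, so only the left multiplications survive. *)
Lemma H_Dx n u : H (u * Dx n) + H u * Dx n.+1 = u.
Proof.
rewrite (on_leftDx etaL) /Dx mulrDr -scalerAr exprS mulN1r scaleNr.
by rewrite addrACA H_X subrr addr0.
Qed.

Lemma H_Dy n u : H (u * Dy n) + H u * Dy n.+1 = 0.
Proof.
rewrite (on_leftDy etaL) /Dy mulrDr -scalerAr exprS mulN1r scaleNr.
by rewrite addrACA H_Y subrr addr0.
Qed.

Lemma Th_Dx n u : Th (u * Dx n.+1) - (-1) ^+ n *: (Kp (u * Dx n.+1) * XR) = 0.
Proof.
rewrite (on_leftDx thetaL) (on_leftDx kappaL) Th_X Kp_X add0r mulrDl -scalerAl.
rewrite -[_ * XR * XR]mulrA XRR mulr0 scaler0 addr0 exprS mulN1r scaleNr.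
by rewrite mulNr scalerN opprK addNr.
Qed.

Lemma Th_Dy n u : H u * Dx n + (Th u - (-1) ^+ n.+1 *: (Kp u * XR)) * Dy n
  + (Th (u * Dy n.+1) - (-1) ^+ n *: (Kp (u * Dy n.+1) * XR)) = u.
Proof.
rewrite (on_leftDy thetaL) (on_leftDy kappaL) Kp_Y exprS mulN1r !scaleNr opprK.
rewrite /Dx /Dy !mulrDr !mulrDl !scalerDr !opprD -!scalerAl -!scalerAr -!mulrA YLXR.
rewrite mulNr -scalerAl -mulrA YRXR mulrN !scalerN !opprK.
rewrite -[RHS]unit_decompE; exact: cancel_Th.
Qed.

Lemma H_defect u : H u * Dx 1 + (Th u - Kp u * XR) * Dy 1 = u - defect u.
Proof.
rewrite -[X in _ = X - _]unit_decompE /defect Kp_Y /Dx /Dy expr1 !scaleN1r.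
rewrite !mulrBl !mulrBr !mulrDl -!mulrA YLXR.
exact: cancel_defect.
Qed.

Lemma kcoefD n (f g : koszul n) p q : kcoef (f + g) p q = kcoef f p q + kcoef g p q.
Proof. by have := kcoefP 1 f g p q; rewrite scale1r mul1r. Qed.

Lemma DxSS n : Dx n.+2 = Dx n. Proof. by rewrite /Dx !exprS mulrA mulrNN !mul1r. Qed.
Lemma DySS n : Dy n.+2 = Dy n. Proof. by rewrite /Dy !exprS mulrA mulrNN !mul1r. Qed.

Lemma khomotopyP n (f : koszul n.+1) :
  f = kdiff (khomotopy f) + khomotopy (kdiff f).
Proof.
apply: koszulP => p q.
have [pqn|] := eqVneq (p + q)%N n.+1; last by move=> pqn; rewrite !kcoef0.
rewrite kcoefD !kcoef_mk /kdfun !kcoef_mk /khfun /kdfun.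
case: p pqn => [|p] pqn.
  case: q pqn => [|q] // [qn].
    rewrite qn kcoef_mk /kdfun !DxSS !DySS (on_leftD thetaL) (on_leftD kappaL) [(Kp _ + Kp _) * XR]mulrDl scalerDr opprD.
  by rewrite [Th _ + Th _ + _]addrACA Th_Dx add0r Th_Dy.
rewrite kcoef_mk /kdfun (on_leftD etaL) [RHS]addrC [RHS]addrACA H_Dx.
by rewrite H_Dy addr0.
Qed.

Lemma khomotopy0 (f : koszul 0) :
  kcoef (kdiff (khomotopy f)) 0 0 = kcoef f 0 0 - sigma (kcoef f 0 0).
Proof.
rewrite -defect_sigma -?H_defect; last exact: kcoef_eps.
by rewrite kcoef_mk /kdfun !kcoef_mk /khfun expr0 scale1r.
Qed.

(** The generators of the terms: the family eps n%:R at (p, q), which is zero if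
    p + q differs from n. *)
Definition kgfun n p q (p' q' : nat) : E :=
  if [&& p' == p, q' == q & (p + q == n)%N] then eps n%:R else 0.

Fact kgfunP n p q : koszul_pred n (kgfun n p q).
Proof.
apply/asboolP => p' q'; rewrite /kgfun; split.
  by case: ifP => _; rewrite ?eps_idem ?mul0r.
by case: ifP => // /and3P[/eqP-> /eqP-> ->].
Qed.

Definition kgen n p q : koszul n := mk_koszul (kgfunP n p q).

Lemma koszul_sum n (I : Type) (r : seq I) (P : pred I) (F : I -> koszul n) p q :
  kcoef (\sum_(i <- r | P i) F i) p q = \sum_(i <- r | P i) kcoef (F i) p q.
Proof. by elim/big_rec2: _ => // i u v _ <-; rewrite kcoefD. Qed.

Lemma kcoefZ n c (f : koszul n) p q : kcoef (c *: f) p q = c * kcoef f p q.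
Proof. by have := kcoefP c f 0 p q; rewrite !addr0. Qed.

Lemma koszul_expand n (f : koszul n) :
  f = \sum_(p < n.+1) kcoef f p (n - p)%N *: kgen n p (n - p)%N.
Proof.
apply: koszulP => p q; rewrite koszul_sum.
have [pqn|] := eqVneq (p + q)%N n; last first.
  move=> pqn; rewrite kcoef0 // big1 // => i _.
  by rewrite kcoefZ [kcoef (kgen _ _ _) _ _]kcoef0 ?mulr0.
have pn : (p < n.+1)%N by rewrite ltnS -pqn leq_addr.
rewrite (bigD1 (Ordinal pn)) //= big1 ?addr0 => [|i ip].
  have nq : (n - p)%N = q by rewrite -pqn addKn.
  by rewrite kcoefZ kcoef_mk /kgfun nq pqn !eqxx kcoef_eps.
rewrite kcoefZ kcoef_mk /kgfun; case: eqP => [pi|_] /=; last by rewrite mulr0.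
by case/eqP: ip; apply/val_inj.
Qed.

Section MapsOut.
Variables (N : lmodType E) (n : nat).

Definition kmap (v : nat -> nat -> N) (f : koszul n) : N :=
  \sum_(p < n.+1) kcoef f p (n - p)%N *: v p (n - p)%N.

Lemma kmap_linear v : linear (kmap v).
Proof.
move=> c f g; rewrite /kmap scaler_sumr -big_split; apply: eq_bigr => p _ /=.
by rewrite kcoefP scalerDl scalerA.
Qed.
HB.instance Definition _ v := GRing.isLinear.Build E (koszul n) N *:%R
  (kmap v) (kmap_linear v).

Lemma kmap_gen v p q : (p + q)%N = n -> kmap v (kgen n p q) = eps n%:R *: v p q.
Proof.
move=> pqn; have pn : (p < n.+1)%N by rewrite ltnS -pqn leq_addr.
have nq : (n - p)%N = q by rewrite -pqn addKn.
rewrite /kmap (bigD1 (Ordinal pn)) //= big1 ?addr0 => [|i ip].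
  by rewrite kcoef_mk /kgfun nq pqn !eqxx.
rewrite kcoef_mk /kgfun; case: eqP => [pi|_] /=; last by rewrite scale0r.
by case/eqP: ip; apply/val_inj.
Qed.

Lemma kmapE (g : {linear koszul n -> N}) f : g f = kmap (fun p q => g (kgen n p q)) f.
Proof.
rewrite {1}[f]koszul_expand raddf_sum; apply: eq_bigr => p _.
exact: linearZ_LR.
Qed.
End MapsOut.

(** A map out of a term is given by arbitrary images of the generators, cut down
    by the idempotent. *)
Lemma koszul_projective n : projective (koszul n).
Proof.
move=> M N g f gS.
have [v vE] := choice (fun pq : nat * nat => gS (f (kgen n pq.1 pq.2))).
exists (kmap (fun p q => v (p, q))) => u.
rewrite [RHS]kmapE /kmap raddf_sum; apply: eq_bigr => p _.
by apply: etrans (linearZ_LR g _ _) _; rewrite vE.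
Qed.

Section Resolution.
(* M is the regular bimodule, read through a bijection with A. *)
Variables (M : lmodType E) (toA : M -> A) (ofA : A -> M).
Hypotheses (toAK : cancel toA ofA) (ofAK : cancel ofA toA).
Hypothesis toAD : forall m m', toA (m + m') = toA m + toA m'.
Hypothesis toA_t : forall a b m, toA (t a b *: m) = b * toA m * a.

Let m0 : M := ofA 1.

Lemma toA_l b m : toA (t 1 b *: m) = b * toA m.
Proof. by rewrite toA_t mulr1. Qed.
Lemma toA_r a m : toA (t a 1 *: m) = toA m * a.
Proof. by rewrite toA_t mul1r. Qed.

Lemma toA0 : toA 0 = 0.
Proof. by apply: (addrI (toA 0)); rewrite -toAD !addr0. Qed.

Lemma toA_sum (I : Type) (r : seq I) (P : pred I) (F : I -> M) :
  toA (\sum_(i <- r | P i) F i) = \sum_(i <- r | P i) toA (F i).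
Proof. by elim/big_rec2: _ => [|i u v _ <-]; rewrite ?toA0 ?toAD. Qed.

Lemma toAZ (c : K) m : toA ((c%:A : E) *: m) = c *: toA m.
Proof. by rewrite -(pure11 TP) -tZr toA_l -scalerAl mul1r. Qed.

Lemma toA_eps d m : toA (eps d *: m) = \sum_i e i * toA m * e (i + d).
Proof. by rewrite /eps scaler_suml toA_sum; apply: eq_bigr => i _; apply: toA_t. Qed.

Lemma m0_gen m : exists u, u *: m0 = m.
Proof. by exists (t 1 (toA m)); apply: (can_inj toAK); rewrite toA_l ofAK mulr1. Qed.

Lemma m0_eps : eps 0 *: m0 = m0.
Proof.
apply: (can_inj toAK); rewrite toA_eps ofAK -(sum_e fr); apply: eq_bigr => i _.
by rewrite addr0 sum_e mulr1 ee eqxx.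
Qed.

Lemma m0_comm a : t 1 a *: m0 = t a 1 *: m0.
Proof. by apply: (can_inj toAK); rewrite toA_l toA_r ofAK mulr1 mul1r. Qed.

(** sigma u depends only on the image u *: m0 of u under the augmentation. *)
Lemma m0_sigma u : u *: m0 = 0 -> sigma u = 0.
Proof.
pose S (a : A) : E := \sum_k t (e k * a) (e k).
have SL : linear S.
  move=> c v w; rewrite /S scaler_sumr -big_split; apply: eq_bigr => k _ /=.
  by rewrite mulrDr -scalerAr tDl tZl.
suff -> : sigma u = S (toA (u *: m0)).
  by move=> ->; rewrite toA0; apply: (linear0 (mk_linear SL)).
move: u; apply: (@pure_ind _ _ _ TP) => [||c b]; first exact: sigma_linear.
  move=> c v w; rewrite -SL; congr S; rewrite -toAZ -toAD scalerA mulr_algl.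
  by rewrite scalerDl.
rewrite toA_t ofAK mulr1 sigmaE; apply: eq_bigr => k _.
by rewrite mulrA.
Qed.

Definition kaug (f : koszul 0) : M := kcoef f 0 0 *: m0.
Lemma kaug_linear : linear kaug.
Proof. by move=> c f g; rewrite /kaug kcoefP scalerDl scalerA. Qed.
HB.instance Definition _ := GRing.isLinear.Build E (koszul 0) M *:%R kaug kaug_linear.

Lemma kaug_diff f : kaug (kdiff f) = 0.
Proof.
rewrite /kaug kcoef_mk /kdfun /Dx /Dy expr1 !scaleN1r.
by rewrite scalerDl -!scalerA !scalerBl !m0_comm !subrr !scaler0 addr0.
Qed.

Lemma kaug_surj m : exists f, kaug f = m.
Proof.
have [u uE] := m0_gen m; exists (u *: kgen 0 0 0).
by rewrite /kaug kcoefZ kcoef_mk /kgfun /= -scalerA m0_eps.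
Qed.

Lemma koszul_exact0 f : kaug f = 0 <-> exists g, kdiff g = f.
Proof.
split=> [kf0|[g <-]]; last exact: kaug_diff.
exists (khomotopy f); apply: koszulP => p q.
have [pq0|pq0] := eqVneq (p + q)%N 0%N; last by rewrite !kcoef0.
have [-> ->] : p = 0%N /\ q = 0%N by case: p q pq0 => [] [].
by rewrite khomotopy0 m0_sigma ?subr0.
Qed.

Lemma koszul_exact n f : kdiff f = 0 <-> exists g : koszul n.+2, kdiff g = f.
Proof.
split=> [kf0|[g <-]]; last exact: kdiffK.
exists (khomotopy f); rewrite [RHS]khomotopyP kf0.
rewrite (_ : khomotopy 0 = 0) ?addr0 //.
apply: koszulP => p q; rewrite kcoef_mk /khfun.
have z p' q' : kcoef (0 : koszul n) p' q' = 0 by [].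
case: p q => [|p] [|q] //; rewrite z ?(on_left0 etaL) ?(on_left0 thetaL) ?(on_left0 kappaL) //.
by rewrite mul0r scaler0 subr0.
Qed.

Definition koszul_resolution : proj_resolution M :=
  @ProjResolution E M (fun n => koszul n) (fun n => @kdiff n) kaug koszul_projective
    kaug_surj koszul_exact0 koszul_exact.

(** * Cochains in coordinates *)

Section Cochains.
Hypothesis s_gt2 : (2 < s)%N.

Definition mcoord (m : M) : frame_space K s := coord fr (toA m).

Lemma mcoord_xl m k a b :
  mcoord (XL *: m) k a b = if a then mcoord m (k + 1) false b else 0.
Proof. by rewrite /mcoord toA_l coordxM. Qed.
Lemma mcoord_xr m k a b :
  mcoord (XR *: m) k a b = if a then (-1) ^+ b * mcoord m k false b else 0.
Proof. by rewrite /mcoord toA_r coordMx. Qed.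
Lemma mcoord_yl m k a b :
  mcoord (YL *: m) k a b = if b then (-1) ^+ a * mcoord m (k + 1) a false else 0.
Proof. by rewrite /mcoord toA_l coordyM. Qed.
Lemma mcoord_yr m k a b : mcoord (YR *: m) k a b = if b then mcoord m k a false else 0.
Proof. by rewrite /mcoord toA_r coordMy. Qed.
Lemma mcoord_eps d m k (a b : bool) : mcoord (eps d *: m) k a b =
  if a%:R + b%:R == d then mcoord m k a b else 0.
Proof.
rewrite /mcoord toA_eps coord_sum (bigD1 k) //= big1 ?addr0 => [|i ik].
  by rewrite coordMe -addrA (inj_eq (addrI _)) coordeM eqxx.
by rewrite coordMe coordeM [k == i]eq_sym (negPf ik) if_same.
Qed.

Lemma mcoordD m m' k a b : mcoord (m + m') k a b = mcoord m k a b + mcoord m' k a b.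
Proof. by rewrite /mcoord toAD coordD. Qed.
Lemma mcoord0 k a b : mcoord 0 k a b = 0.
Proof. by rewrite /mcoord toA0 coord0. Qed.
Lemma mcoordZ (c : K) m k a b : mcoord ((c%:A : E) *: m) k a b = c * mcoord m k a b.
Proof. by rewrite /mcoord toAZ coordZ. Qed.
Lemma mcoordP (c : K) m m' k a b :
  mcoord ((c%:A : E) *: m + m') k a b = c * mcoord m k a b + mcoord m' k a b.
Proof. by rewrite mcoordD mcoordZ. Qed.
Lemma mcoord_inj m m' : (forall k a b, mcoord m k a b = mcoord m' k a b) -> m = m'.
Proof. by move=> mm'; apply: (can_inj toAK); apply: coordP mm'. Qed.

(** Multiplication from the left shifts the vertex and multiplication from the
    right does not, so Dx n becomes a twisted difference operator. *)
Lemma mcoord_Dx n m k a b : mcoord (Dx n *: m) k a b =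
  if a then cdiff ((-1) ^+ (n.+1 + b)) (fun k => mcoord m k false b) k else 0.
Proof.
rewrite /Dx scalerDl mcoordD mcoord_xl -[(-1) ^+ n *: XR]mulr_algl -scalerA mcoordZ mcoord_xr.
case: a; rewrite ?mulr0 ?addr0 // /cdiff mulrA -exprD addSn exprS mulN1r.
by rewrite mulNr opprK.
Qed.

Lemma mcoord_Dy n m k a b : mcoord (Dy n *: m) k a b = if b then
  (-1) ^+ a * cdiff ((-1) ^+ (n.+1 + a)) (fun k => mcoord m k a false) k else 0.
Proof.
rewrite /Dy scalerDl mcoordD mcoord_yl -[(-1) ^+ n *: YR]mulr_algl -scalerA mcoordZ mcoord_yr.
case: b; rewrite ?mulr0 ?addr0 // /cdiff mulrBr; congr (_ + _).
rewrite mulrA -exprD addnCA addnn addSn -[(n + a.*2)%N.+1]addSn exprD.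
by rewrite -mul2n exprM sqrrN expr1n expr1n mulr1 exprS mulN1r mulNr opprK.
Qed.

Lemma kgen0 n p q : (p + q)%N != n -> kgen n p q = 0.
Proof.
by move=> pqn; apply: koszulP => p' q'; rewrite kcoef_mk /kgfun (negPf pqn) !andbF.
Qed.

Lemma kdiff_gen n p q : kdiff (kgen n.+1 p q) =
  (if p is p'.+1 then Dx n.+1 *: kgen n p' q else 0) +
  (if q is q'.+1 then Dy n.+1 *: kgen n p q' else 0).
Proof.
apply: koszulP => p' q'; rewrite kcoefD kcoef_mk /kdfun !kcoef_mk; congr (_ + _).
  case: p => [|p]; first by rewrite /kgfun mul0r.
  rewrite kcoefZ kcoef_mk /kgfun !eqSS.
  by case: ifP; rewrite ?mul0r ?mulr0 // -natr1 epsDx.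
case: q => [|q]; first by rewrite /kgfun andbF mul0r.
rewrite kcoefZ kcoef_mk /kgfun !eqSS addnS eqSS.
by case: ifP; rewrite ?mul0r ?mulr0 // -natr1 epsDy.
Qed.

Lemma hom_gen_eq n (z z' : hom (koszul n) M) :
  (forall p q, hom_fun z (kgen n p q) = hom_fun z' (kgen n p q)) -> z = z'.
Proof.
move=> zz'; apply: hom_inj => f.
apply: etrans (kmapE (mk_linear (hom_lin z)) f) _.
apply: etrans _ (esym (kmapE (mk_linear (hom_lin z')) f)).
by apply: eq_bigr => p _ /=; rewrite zz'.
Qed.

(** Coordinates of a cochain z: those of its values at the generators.  They
    determine z, and the families that occur are the [cochain n] below. *)
Definition cocoord n (z : hom (koszul n) M) p q : frame_space K s :=
  mcoord (hom_fun z (kgen n p q)).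

Lemma cocoord_inj n (z z' : hom (koszul n) M) :
  (forall p q k a b, cocoord z p q k a b = cocoord z' p q k a b) -> z = z'.
Proof. by move=> zz'; apply: hom_gen_eq => p q; apply: mcoord_inj; apply: zz'. Qed.

Lemma cocoordP n (c : K) (z z' : hom (koszul n) M) p q k a b :
  cocoord (c *: z + z') p q k a b = c * cocoord z p q k a b + cocoord z' p q k a b.
Proof. exact: mcoordP. Qed.

Lemma hom_lin0 (U : lmodType E) (z : hom U M) : hom_fun z 0 = 0.
Proof. exact: (linear0 (mk_linear (hom_lin z))). Qed.
Lemma hom_linD (U : lmodType E) (z : hom U M) u v :
  hom_fun z (u + v) = hom_fun z u + hom_fun z v.
Proof. exact: (linearD (mk_linear (hom_lin z))). Qed.
Lemma hom_linZ (U : lmodType E) (z : hom U M) c u :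
  hom_fun z (c *: u) = c *: hom_fun z u.
Proof. exact: (linearZ_LR (mk_linear (hom_lin z))). Qed.

Lemma cocoord_total n (z : hom (koszul n) M) p q k a b : (p + q)%N != n -> cocoord z p q k a b = 0.
Proof. by move=> pqn; rewrite /cocoord kgen0 // hom_lin0 mcoord0. Qed.

Lemma cocoord_degree n (z : hom (koszul n) M) p q k (a b : bool) : a%:R + b%:R != n%:R :> 'Z_s ->
  cocoord z p q k a b = 0.
Proof.
move=> abn; rewrite /cocoord.
have [pqn|] := eqVneq (p + q)%N n; last by move=> ?; rewrite kgen0 ?hom_lin0 ?mcoord0.
have -> : kgen n p q = eps n%:R *: kgen n p q.
  apply: koszulP => p' q'; rewrite kcoefZ kcoef_mk /kgfun.
  by case: ifP; rewrite ?mulr0 ?eps_idem.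
by rewrite hom_linZ mcoord_eps (negPf abn).
Qed.

(** The first condition is the support of the generators; the second one is
    invariance under eps n%:R. *)
Definition cochain n (w : nat -> nat -> frame_space K s) :=
  (forall p q k a b, (p + q)%N != n -> w p q k a b = 0) /\
  (forall p q k (a b : bool), a%:R + b%:R != n%:R :> 'Z_s -> w p q k a b = 0).

Lemma cocoord_surj n w : cochain n w -> exists z : hom (koszul n) M, cocoord z = w.
Proof.
move=> [w1 w2].
exists (mk_hom (kmap_linear (fun p q => ofA (of_coord fr (w p q))) : linear (_ : koszul n -> M))).
apply/funext => p; apply/funext => q; apply/funext => k; apply/funext => a; apply/funext => b.
have [pqn|pqn] := eqVneq (p + q)%N n; last by rewrite cocoord_total // w1.
rewrite /cocoord [hom_fun _ _]kmap_gen // mcoord_eps /mcoord ofAK of_coordK.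
by case: ifP => // /negbT abn; rewrite w2.
Qed.

(** The cochain differential in coordinates.  Its component at (p, q) only sees
    the components at (p - 1, q) and (p, q - 1), through x and y. *)
Definition codiff n (w : nat -> nat -> frame_space K s) p q (k : 'Z_s) (a b : bool) : K :=
  (if p is p'.+1 then if a then
     cdiff ((-1) ^+ (n + b)) (fun k => w p' q k false b) k else 0 else 0) +
  (if q is q'.+1 then if b then
     (-1) ^+ a * cdiff ((-1) ^+ (n + a)) (fun k => w p q' k a false) k else 0 else 0).

Lemma cocoord_diff n (z : hom (koszul n) M) p q k a b :
  mcoord (hom_fun z (kdiff (kgen n.+1 p q))) k a b = codiff n (cocoord z) p q k a b.
Proof.
rewrite kdiff_gen hom_linD mcoordD /codiff; congr (_ + _).
  case: p => [|p]; first by apply: etrans (mcoord0 k a b); congr (mcoord _ k a b); apply: hom_lin0.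
  by rewrite hom_linZ mcoord_Dx !exprD !exprS mulrA mulrNN !mul1r.
case: q => [|q]; first by apply: etrans (mcoord0 k a b); congr (mcoord _ k a b); apply: hom_lin0.
by rewrite hom_linZ mcoord_Dy ![in LHS]exprD !exprS !mulrA mulrNN !mul1r exprD.
Qed.

Local Notation P := koszul_resolution.

Lemma cocoord_cocycle n (z : hom (P n) M) :
  is_cocycle z <-> forall p q k a b, codiff n (cocoord z) p q k a b = 0.
Proof.
split=> [/asboolP zc p q k a b|zc].
  by rewrite -cocoord_diff -[kdiff _]/(res_diff P n _) zc mcoord0.
apply/asboolP => f.
have -> : hom_fun z (res_diff P n f) = hom_fun (hom_comp (res_diff P n) z) f by [].
have -> : hom_comp (res_diff P n) z = 0; last by [].
by apply: cocoord_inj => p q k a b; rewrite /cocoord [LHS]cocoord_diff zc mcoord0.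
Qed.

Lemma cocoord_coboundary n (z : hom (P n.+1) M) :
  is_coboundary z <-> exists2 w, cochain n w &
    forall p q k a b, cocoord z p q k a b = codiff n w p q k a b.
Proof.
split=> [[g zg]|[w wc zw]].
  exists (cocoord g) => [|p q k a b]; last by rewrite -cocoord_diff /cocoord zg.
  by split=> p q k a b; [exact: cocoord_total | exact: cocoord_degree].
have [g gw] := cocoord_surj wc; exists g => f.
have -> : z = hom_comp (res_diff P n) g; last by [].
by apply: cocoord_inj => p q k a b; rewrite zw -gw -cocoord_diff.
Qed.

Lemma cochain0 n (z : hom (P n) M) :
  (forall p q k a b, cocoord z p q k a b = 0) -> is_coboundary z.
Proof.
move=> z0; have -> : z = 0 by apply: cocoord_inj => p q k a b; rewrite z0 /cocoord mcoord0.
by case: n {z z0} => [|n] //; exists 0.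
Qed.

Lemma Ext_dim0 n : (forall z : hom (P n) M, is_cocycle z -> is_coboundary z) ->
  has_dim (Ext M P n) 0.
Proof.
move=> zcb; apply: (@has_dim_Ext _ _ _ _ P n 0 (fun=> 0)) => [k u v|z /zcb //|u].
  by rewrite scaler0 addr0.
by exists 0; [case: (@is_cocycle_submod _ _ M M P n) | rewrite [u]thinmx0].
Qed.

(** Degrees of monomials are at most 2 < s, so the congruence modulo s between
    a + b and n is an equality with the remainder of n. *)
Lemma degree_eq n r (a b : bool) : (r < s)%N -> n%:R = r%:R :> 'Z_s ->
  (a%:R + b%:R == n%:R :> 'Z_s) = (a + b == r)%N.
Proof.
move=> rs ->; rewrite -natrD -val_eqE /= !val_Zp_nat ?(ltnW s_gt2) //.
by rewrite !modn_small //; apply: leq_ltn_trans s_gt2; case: a b => [] [].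
Qed.

Lemma cocoord_deg0 n r (z : hom (P n) M) p q k (a b : bool) : (r < s)%N ->
  n%:R = r%:R :> 'Z_s -> (a + b)%N != r -> cocoord z p q k a b = 0.
Proof. by move=> rs nr abr; rewrite cocoord_degree // (degree_eq _ _ rs nr). Qed.

Lemma cocoord_surj_deg n r w : (r < s)%N -> n%:R = r%:R :> 'Z_s ->
  (forall p q k (a b : bool), (p + q)%N != n -> w p q k a b = 0) ->
  (forall p q k (a b : bool), (a + b)%N != r -> w p q k a b = 0) ->
  exists z : hom (P n) M, cocoord z = w.
Proof.
move=> rs nr w1 w2; apply: cocoord_surj; split=> // p q k a b.
by rewrite (degree_eq _ _ rs nr); apply: w2.
Qed.

Lemma Ext_dim_gt2 n r : (2 < r < s)%N -> n%:R = r%:R :> 'Z_s ->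
  has_dim (Ext M P n) 0.
Proof.
case/andP=> r2 rs nr; apply: Ext_dim0 => z _; apply: cochain0 => p q k a b.
rewrite (cocoord_deg0 _ _ _ _ rs nr) //.
by apply: contraTneq r2 => <-; case: a b => [] [].
Qed.

Section LowDegrees.
(* From here on N is a multiple of s, and the degree is N, N + 1 or N + 2. *)
Variable N : nat.
Hypothesis N0 : N%:R = 0 :> 'Z_s.
Local Notation sgn := ((-1) ^+ N : K).
Local Notation T := (cdiff sgn).

Lemma sgn0 : (-1) ^+ (N + false) = sgn. Proof. by rewrite addn0. Qed.
Lemma sgn2 : (-1) ^+ (N.+1 + true) = sgn.
Proof. by rewrite addn1 !exprS mulrA mulrNN !mul1r. Qed.

Lemma N1 : N.+1%:R = 1%:R :> 'Z_s. Proof. by rewrite -natr1 N0 add0r. Qed.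
Lemma N2 : N.+2%:R = 2%:R :> 'Z_s. Proof. by rewrite -natr1 N1. Qed.
Let s0 : (0 < s)%N. Proof. exact: leq_trans s_gt2. Qed.
Let s1 : (1 < s)%N. Proof. exact: leq_trans s_gt2. Qed.
Let Nz : N%:R = 0%N%:R :> 'Z_s. Proof. exact: N0. Qed.

Lemma cdiffZ c (f : 'Z_s -> K) k : T (fun i => c * f i) k = c * T f k.
Proof. by rewrite /cdiff mulrBr mulrCA. Qed.
Lemma cdiff0 c (f : 'Z_s -> K) k : (forall i, f i = 0) -> cdiff c f k = 0.
Proof. by move=> f0; rewrite /cdiff !f0 mulr0 subr0. Qed.
Lemma cdiffB (f g : 'Z_s -> K) k : T (fun i => f i - g i) k = T f k - T g k.
Proof. by rewrite /cdiff mulrBr !opprB addrACA [RHS]addrACA; congr (_ + _); rewrite addrC. Qed.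

Lemma cocycle0P (z : hom (P N) M) : is_cocycle z <->
  forall p q k, T (fun i => cocoord z p q i false false) k = 0.
Proof.
split=> [/cocoord_cocycle zc p q k|zc].
  by have := zc p.+1 q k true false; rewrite /codiff sgn0; case: q => [|q]; rewrite addr0.
apply/cocoord_cocycle => p q k a b; rewrite /codiff.
have T1 c p' q' i (a' b' : bool) : a' || b' ->
    cdiff c (fun i => cocoord z p' q' i a' b') i = 0.
  move=> ab; apply: cdiff0 => j; apply: (cocoord_deg0 _ _ _ _ s0 Nz).
  by case: a' b' ab => [] [].
have T0 p' q' i : cdiff ((-1) ^+ (N + false)) (fun i => cocoord z p' q' i false false) i = 0.
  by rewrite sgn0; apply: zc.
by case: p q a b => [|p] [|q] [] []; rewrite ?T0 ?T1 ?mulr0 ?addr0.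
Qed.

(** A differential takes values in positive degree monomials; so in degree N
    every coboundary vanishes. *)
Lemma coboundary0_ff n (z : hom (P n) M) p q k : is_coboundary z ->
  cocoord z p q k false false = 0.
Proof.
case: n z => [|n] z; first by move=> ->; rewrite /cocoord mcoord0.
by move=> /cocoord_coboundary[w _ ->]; rewrite /codiff; case: p q => [|p] [|q]; rewrite addr0.
Qed.

Lemma Ext0_inj (z : hom (P N) M) :
  (forall p q k, cocoord z p q k false false = 0) -> is_coboundary z.
Proof.
move=> z0; apply: cochain0 => p q k a b.
have [ab|ab] := eqVneq (a + b)%N 0%N; last exact: (cocoord_deg0 _ _ _ _ s0 Nz).
by case: a b ab => [] [].
Qed.
(** A cocycle is a family of N + 1 solutions of T c = 0, each determined by its
    value at vertex 0. *)
Lemma Ext0_good : sgn ^+ s = 1 -> has_dim (Ext M P N) N.+1.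
Proof.
move=> sgnS.
pose phi (z : hom (P N) M) : 'rV[K]_N.+1 :=
  \row_(p < N.+1) cocoord z p (N - p)%N 0 false false.
apply: (@has_dim_Ext _ _ _ _ P N _ phi) => [c u v|z|u].
- by apply/rowP => p; rewrite !mxE cocoordP.
- move=> zcc; have zc := iffLR (cocycle0P z) zcc; split=> [phi0|zb]; last first.
    by apply/rowP => p; rewrite !mxE coboundary0_ff.
  apply: Ext0_inj => p q k.
  have [pqN|] := eqVneq (p + q)%N N; last exact: cocoord_total.
  apply: (cdiff_ker0 (zc p q)).
  have pN : (p < N.+1)%N by rewrite ltnS -pqN leq_addr.
  have /rowP/(_ (Ordinal pN)) := phi0; rewrite !mxE /=.
  by rewrite (_ : N - p = q)%N // -pqN addKn.
have [c c0 Tc] := cdiff_ker_ex s1 sgnS 1.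
pose w p q k (a b : bool) : K := if [&& p + q == N, ~~ a & ~~ b]%N
  then u 0 (inord p) * c k else 0.
have [||z zw] := @cocoord_surj_deg N 0 w s0 Nz.
- by move=> p q k a b /negPf pq; rewrite /w pq.
- by move=> p q k [] []; rewrite /w ?andbF.
exists z.
  apply: (iffRL (cocycle0P z)) => p q k; rewrite zw /w.
  by case: (_ == _); [rewrite cdiffZ Tc mulr0 | apply: cdiff0].
apply/rowP => p; rewrite !mxE zw /w subnKC ?leq_ord // eqxx /= c0 mulr1.
by congr (u _ _); apply/val_inj; rewrite /= inordK.
Qed.

Lemma Ext0_bad : sgn ^+ s = -1 -> 2%:R != 0 :> K -> has_dim (Ext M P N) 0.
Proof.
move=> sgnS K2; apply: Ext_dim0 => z /cocycle0P zc.
by apply: Ext0_inj => p q; apply: (cdiff_inj s1 sgnS K2).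
Qed.

(** For u and v the coordinates of z at e_k x and e_k y, this is
    v_(p-1,q) - u_(p,q-1); by [codiff_delta] the differential of z is T applied
    to it. *)
Definition delta (z : hom (P N.+1) M) p q k : K :=
  (if p is p'.+1 then cocoord z p' q k false true else 0) -
  (if q is q'.+1 then cocoord z p q' k true false else 0).

Lemma cocoord1_0 (z : hom (P N.+1) M) p q k (a b : bool) : a == b ->
  cocoord z p q k a b = 0.
Proof. by move=> ab; apply: (cocoord_deg0 _ _ _ _ s1 N1); case: a b ab => [] []. Qed.

Lemma codiff_delta (z : hom (P N.+1) M) p q k :
  codiff N.+1 (cocoord z) p q k true true = T (delta z p q) k.
Proof.
rewrite /codiff sgn2 /delta expr1.
have T0 : T (fun=> 0) k = 0 by apply: cdiff0.
by case: p => [|p]; case: q => [|q]; rewrite cdiffB ?T0 ?mulN1r ?subr0 ?addr0.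
Qed.

Lemma cocycle1P (z : hom (P N.+1) M) :
  is_cocycle z <-> forall p q k, T (delta z p q) k = 0.
Proof.
split=> [/cocoord_cocycle zc p q k|zc]; first by rewrite -codiff_delta.
apply/cocoord_cocycle => p q k a b.
have T0 c p' q' i (a' : bool) : cdiff c (fun i => cocoord z p' q' i a' a') i = 0.
  by apply: cdiff0 => j; rewrite cocoord1_0.
case: a b => [] []; first by rewrite codiff_delta zc.
all: by rewrite /codiff; case: p q => [|p] [|q]; rewrite ?T0 ?mulr0 ?addr0.
Qed.

(** With f the coordinates at e_k of a cochain of degree N. *)
Lemma coboundary1P (z : hom (P N.+1) M) : is_coboundary z <->
  exists2 f : nat -> nat -> 'Z_s -> K, (forall p q k, (p + q)%N != N -> f p q k = 0) &
  forall p q k, cocoord z p q k true false = (if p is p'.+1 then T (f p' q) k else 0) /\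
    cocoord z p q k false true = (if q is q'.+1 then T (f p q') k else 0).
Proof.
split=> [/cocoord_coboundary[w [w1 _] zw]|[f f0 zf]].
  exists (fun p q k => w p q k false false) => [p q k|p q k]; first exact: w1.
  rewrite !zw /codiff sgn0; case: p q => [|p] [|q]; rewrite ?addr0 ?add0r ?mul1r //.
apply/cocoord_coboundary.
exists (fun p q k a b => if a || b then 0 else f p q k).
  split=> p q k a b; first by move=> pq; rewrite f0 ?if_same.
  by rewrite (degree_eq _ _ s0 Nz); case: a b => [] [].
have T0 (c : K) (i : 'Z_s) : cdiff c (fun=> (0 : K^o)) i = 0 by apply: cdiff0.
move=> p q k [] [].
- by rewrite cocoord1_0 // /codiff /=; case: p q => [|p] [|q]; do ?rewrite [cdiff _ _ _]cdiff0 //; rewrite ?mulr0 ?addr0.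
- by have [-> _] := zf p q k; rewrite /codiff sgn0; case: p q => [|p] [|q]; rewrite ?addr0.
- by have [_ ->] := zf p q k; rewrite /codiff sgn0; case: p q => [|p] [|q]; rewrite ?add0r ?mul1r.
- by rewrite cocoord1_0 // /codiff; case: p q => [|p] [|q]; rewrite ?addr0.
Qed.

(** If delta vanishes, v is determined by u; and f is a preimage of u under T,
    shifted by one in p. *)
Lemma coboundary1_solve (z : hom (P N.+1) M) :
  (forall p q k, delta z p q k = 0) ->
  (forall p q, (p + q)%N = N ->
     exists f : 'Z_s -> K, forall k, T f k = cocoord z p.+1 q k true false) ->
  is_coboundary z.
Proof.
move=> d0 zS.
have fE pq : exists f : 'Z_s -> K,
    ((pq.1 + pq.2)%N != N -> forall k, f k = 0) /\
    (forall k, T f k = cocoord z pq.1.+1 pq.2 k true false).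
  have [pqN|pqN] := eqVneq (pq.1 + pq.2)%N N.
    by have [f fE] := zS _ _ pqN; exists f.
  by exists (fun=> 0); split=> // k; rewrite cocoord_total ?eqSS // cdiff0.
have [f fP] := choice fE.
apply/coboundary1P; exists (fun p q => f (p, q)) => [p q k pqN|p q k].
  by have [-> //] := fP (p, q).
have uE p' q' : cocoord z p' q' k true false = if p' is p''.+1 then T (f (p'', q')) k else 0.
  case: p' => [|p']; last by have [_ ->] := fP (p', q').
  by have /eqP := d0 0%N q'.+1 k; rewrite /delta sub0r oppr_eq0 => /eqP.
split=> //; have /eqP := d0 p.+1 q k; rewrite /delta subr_eq0 => /eqP ->.
by case: q => [|q] //; rewrite uE.
Qed.

Lemma delta_total (z : hom (P N.+1) M) p q k : (p + q)%N != N.+2 -> delta z p q k = 0.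
Proof.
move=> pq; have h0 p' q' a b : (p' + q').+1 = (p + q)%N -> cocoord z p' q' k a b = 0.
  by move=> pqE; apply: cocoord_total; apply: contraNneq pq => pqN; rewrite -pqE pqN.
rewrite /delta; case: p pq h0 => [|p] pq h0; case: q pq h0 => [|q] pq h0;
  by rewrite ?h0 ?addnS ?addSn ?addn0 ?subr0.
Qed.

Lemma coboundary1_delta (z : hom (P N.+1) M) : is_coboundary z ->
  forall p q k, delta z p q k = 0.
Proof.
move=> /coboundary1P[f _ zf] p q k; rewrite /delta.
case: p => [|p]; case: q => [|q]; rewrite ?subr0 ?sub0r //.
- by have [-> _] := zf 0%N q k; rewrite oppr0.
- by have [_ ->] := zf p 0%N k.
have [-> _] := zf p.+1 q k; have [_ ->] := zf p q.+1 k.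
by rewrite subrr.
Qed.
Lemma Ext1_bad : sgn ^+ s = -1 -> 2%:R != 0 :> K -> has_dim (Ext M P N.+1) 0.
Proof.
move=> sgnS K2; apply: Ext_dim0 => z zc; apply: coboundary1_solve => p q.
  by apply: (cdiff_inj s1 sgnS K2); apply: (iffLR (cocycle1P z)).
by move=> _; apply: (cdiff_surj s1 sgnS K2 (fun k => cocoord z p.+1 q k true false)).
Qed.

Lemma deltaP (c : K) (z z' : hom (P N.+1) M) p q k :
  delta (c *: z + z') p q k = c * delta z p q k + delta z' p q k.
Proof.
have e (a a' b b' : K) : c * (a - a') + (b - b') = c * a + b - (c * a' + b').
  by rewrite mulrBr opprD addrACA.
by rewrite /delta e; case: p q => [|p] [|q]; rewrite ?mulr0 ?addr0 ?cocoordP.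
Qed.

(** Classes are detected by the values at vertex 0 of the N + 3 functions
    delta z p q in ker T, and by the classes of the N + 1 functions u_(p+1,q)
    modulo the image of T. *)
Lemma Ext1_good : sgn ^+ s = 1 -> has_dim (Ext M P N.+1) (N.+3 + N.+1).
Proof.
move=> sgnS.
pose phi1 (z : hom (P N.+1) M) : 'rV[K]_N.+3 :=
  \row_(p < N.+3) delta z p (N.+2 - p)%N 0.
pose phi2 (z : hom (P N.+1) M) : 'rV[K]_N.+1 :=
  \row_(p < N.+1) csum sgn (fun k => cocoord z p.+1 (N - p)%N k true false).
apply: (@has_dim_Ext _ _ _ _ P N.+1 _ (fun z => row_mx (phi1 z) (phi2 z))) => [c u v|z zc|u].
- rewrite scale_row_mx add_row_mx; congr row_mx; apply/rowP => p; rewrite !mxE.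
    exact: deltaP.
  rewrite -csum_linear; congr csum; apply/funext => k; exact: cocoordP.
- have {}zc := iffLR (cocycle1P z) zc; split=> [phi0|zb]; last first.
    have d0 := coboundary1_delta zb.
    have /coboundary1P[f _ zf] := zb.
    rewrite -row_mx0; congr row_mx; apply/rowP => p; rewrite !mxE ?d0 //.
    rewrite -[RHS](csum_cdiff0 s1 sgnS (f p (N - p)%N)); congr csum.
    by apply/funext => k; have [-> _] := zf p.+1 (N - p)%N k.
  have [phi10 phi20] : phi1 z = 0 /\ phi2 z = 0.
    by apply: eq_row_mx; rewrite phi0 row_mx0.
  apply: coboundary1_solve => p q.
    have [pqN|] := eqVneq (p + q)%N N.+2; last by move=> ? ?; apply: delta_total.
    apply: (cdiff_ker0 (zc p q)).
    have pN : (p < N.+3)%N by rewrite ltnS -pqN leq_addr.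
    have /rowP/(_ (Ordinal pN)) := phi10; rewrite !mxE /=.
    by rewrite (_ : N.+2 - p = q)%N // -pqN addKn.
  move=> pqN; apply: (csum0_solve s1).
  have pN : (p < N.+1)%N by rewrite ltnS -pqN leq_addr.
  have /rowP/(_ (Ordinal pN)) := phi20; rewrite !mxE /=.
  by rewrite (_ : N - p = q)%N // -pqN addKn.
have [c c0 Tc] := cdiff_ker_ex s1 sgnS 1.
have [C CE] := choice (csum_surj sgn s1).
pose u1 p := lsubmx u 0 (inord p : 'I_N.+3).
pose u2 p := rsubmx u 0 (inord p : 'I_N.+1).
(* The u_(p+1,q) are prescribed modulo im T; u_(0,q) and the v_(p,q) are
   then forced by the prescribed values of delta. *)
pose w p q k (a b : bool) : K := if (p + q == N.+1)%N then
    if a then if b then 0 else if p is p'.+1 then C (u2 p') k else - (u1 0%N * c k)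
    else if b then u1 p.+1 * c k + (if q is q'.+1 then C (u2 p) k else 0) else 0
  else 0.
have [||z zw] := @cocoord_surj_deg N.+1 1 w s1 N1.
- by move=> p q k a b /negPf pq; rewrite /w pq.
- by move=> p q k [] []; rewrite /w ?if_same.
have dE p q k : (p + q)%N = N.+2 -> delta z p q k = u1 p * c k.
  rewrite /delta zw /w; case: p => [|p] pq.
    case: q pq => [|q] // [qE].
    by rewrite add0n qE eqxx sub0r opprK.
  case: q pq => [|q]; first by rewrite addn0 => -[->]; rewrite addn0 eqxx subr0 addr0.
  rewrite addnS addSn => -[pqN]; rewrite addnS pqN eqxx.
  by rewrite addrK.
exists z.
  apply: (iffRL (cocycle1P z)) => p q k.
  have [pqN|pqN] := eqVneq (p + q)%N N.+2; last first.
    by apply: cdiff0 => i; apply: delta_total.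
  have -> : delta z p q = fun k => u1 p * c k by apply/funext => i; apply: dE.
  by rewrite cdiffZ Tc mulr0.
rewrite -[RHS]hsubmxK; congr row_mx; apply/rowP => p; rewrite !mxE.
  rewrite dE ?subnKC ?leq_ord // c0 mulr1 /u1 mxE; congr (u _ (lshift _ _)).
  by apply/val_inj; rewrite /= inordK.
rewrite zw /w addSn subnKC ?leq_ord // eqxx CE /u2 mxE; congr (u _ (rshift _ _)).
by apply/val_inj; rewrite /= inordK.
Qed.

Lemma cocoord2_0 (z : hom (P N.+2) M) p q k (a b : bool) : ~~ (a && b) ->
  cocoord z p q k a b = 0.
Proof. by move=> ab; apply: (cocoord_deg0 _ _ _ _ s_gt2 N2); case: a b ab => [] []. Qed.

Lemma cocycle2P (z : hom (P N.+2) M) : is_cocycle z.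
Proof.
apply/cocoord_cocycle => p q k a b; rewrite /codiff.
have T1 c p' q' i b' : cdiff c (fun i => cocoord z p' q' i false b') i = 0.
  by apply: cdiff0 => j; rewrite cocoord2_0.
have T2 c p' q' i a' : cdiff c (fun i => cocoord z p' q' i a' false) i = 0.
  by apply: cdiff0 => j; rewrite cocoord2_0 // andbF.
by case: p q => [|p] [|q]; rewrite ?T1 ?T2 ?mulr0 ?if_same ?addr0.
Qed.

(** Preimages under T of the components of z are taken as v_(p-1,q) for positive
    p, and as - u_(0,q-1) for p = 0; the other u are zero. *)
Lemma coboundary2_solve (z : hom (P N.+2) M) :
  (forall p q, exists f : 'Z_s -> K, forall k, T f k = cocoord z p q k true true) ->
  is_coboundary z.
Proof.
move=> zS.
have [f fE] := choice (fun pq => zS pq.1 pq.2).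
pose w p q k (a b : bool) : K := if (p + q == N.+1)%N then
    if a then if b then 0 else if p is 0 then - f (0%N, q.+1) k else 0
    else if b then f (p.+1, q) k else 0
  else 0.
apply/cocoord_coboundary; exists w.
  split=> p q k a b; first by move=> /negPf pq; rewrite /w pq.
  by rewrite (degree_eq _ _ s1 N1) /w; case: a b => [] []; rewrite ?if_same.
have wd a p q k : w p q k a a = 0 by rewrite /w; case: a; rewrite if_same.
move=> p q k a b.
have [/andP[-> ->]|ab] := boolP (a && b); last first.
  rewrite cocoord2_0 // /codiff.
  by case: a b ab => [] [] //= _; case: p q => [|p] [|q];
    do ?rewrite [cdiff _ _ _]cdiff0 ?mulr0 //; rewrite addr0.
have [pq|pq] := eqVneq (p + q)%N N.+2; last first.
  have w0 p' q' c k' a' b' : (p' + q').+1 = (p + q)%N ->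
      cdiff c (fun k => w p' q' k a' b') k' = 0.
    move=> pqE; apply: cdiff0 => i; rewrite /w ifN //.
    by apply: contraNneq pq => pqN; rewrite -pqE pqN.
  rewrite cocoord_total // /codiff.
  case: p pq w0 => [|p] pq w0; case: q pq w0 => [|q] pq w0;
    by do ?rewrite [cdiff _ _ _]w0 ?addnS ?addSn ?addn0 ?mulr0 //; rewrite addr0.
rewrite /codiff /w sgn2 expr1 -(fE (p, q)) /=.
case: p pq => [|p] pq.
  case: q pq => [|q] // [qN].
  by rewrite add0r mulN1r qN eqxx /cdiff mulrN opprB opprK addrC.
case: q pq => [|q]; first by rewrite addn0 => -[->]; rewrite addn0 eqxx addr0.
rewrite addnS addSn => -[pqN]; rewrite !addnS pqN eqxx.
by rewrite [X in _ = _ + _ * X]cdiff0 // mulr0 addr0.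
Qed.

Lemma Ext2_bad : sgn ^+ s = -1 -> 2%:R != 0 :> K -> has_dim (Ext M P N.+2) 0.
Proof.
move=> sgnS K2; apply: Ext_dim0 => z _; apply: coboundary2_solve => p q.
exact: (cdiff_surj s1 sgnS K2 (fun k => cocoord z p q k true true)).
Qed.

(** All cochains of degree N + 2 are cocycles, and coboundaries are the families
    with components in the image of T. *)
Lemma Ext2_good : sgn ^+ s = 1 -> has_dim (Ext M P N.+2) N.+3.
Proof.
move=> sgnS.
pose phi (z : hom (P N.+2) M) : 'rV[K]_N.+3 :=
  \row_(p < N.+3) csum sgn (fun k => cocoord z p (N.+2 - p)%N k true true).
apply: (@has_dim_Ext _ _ _ _ P N.+2 _ phi) => [c u v|z _|u].
- apply/rowP => p; rewrite !mxE -csum_linear; congr csum; apply/funext => k.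
  exact: cocoordP.
- split=> [phi0|/cocoord_coboundary[w _ zw]]; last first.
    apply/rowP => p; rewrite !mxE; move: (nat_of_ord p) (N.+2 - p)%N => {p} p q.
    pose f k := (if p is p'.+1 then w p' q k false true else 0) -
      (if q is q'.+1 then w p q' k true false else 0).
    rewrite -[RHS](csum_cdiff0 s1 sgnS f); congr csum.
    apply/funext => k; rewrite zw /codiff sgn2 /f expr1 cdiffB.
    case: p q {f} => [|p] [|q];
      by do ?rewrite [cdiff _ (fun=> 0) _]cdiff0 //; rewrite ?mulN1r ?subr0 ?addr0.
  apply: coboundary2_solve => p q.
  have [pqN|pqN] := eqVneq (p + q)%N N.+2; last first.
    by exists (fun=> 0) => k; rewrite cdiff0 // cocoord_total.
  apply: (csum0_solve s1).
  have pN : (p < N.+3)%N by rewrite ltnS -pqN leq_addr.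
  have /rowP/(_ (Ordinal pN)) := phi0; rewrite !mxE /=.
  by rewrite (_ : N.+2 - p = q)%N // -pqN addKn.
have [C CE] := choice (csum_surj sgn s1).
pose w p q k (a b : bool) : K :=
  if [&& p + q == N.+2, a & b]%N then C (u 0 (inord p)) k else 0.
have [||z zw] := @cocoord_surj_deg N.+2 2 w s_gt2 N2.
- by move=> p q k a b /negPf pq; rewrite /w pq.
- by move=> p q k [] []; rewrite /w ?andbF.
exists z; first exact: cocycle2P.
apply/rowP => p; rewrite !mxE zw /w subnKC ?leq_ord // eqxx /= CE.
by congr (u _ _); apply/val_inj; rewrite /= inordK.
Qed.

End LowDegrees.

Theorem Ext_dim (m r : nat) : (r < s)%N ->
  has_dim (Ext M P (m * s + r))
    (let good := [|| ~~ odd s, ~~ odd m | 2%N \in [pchar K]] in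
     if (r == 0%N) && good then m * s + 1
     else if (r == 1%N) && good then 2 * m * s + 4
     else if (r == 2%N) && good then m * s + 3
     else 0)%N.
Proof.
move=> rs /=.
have N0 : (m * s)%:R = 0 :> 'Z_s by rewrite natrM Zs_char ?mulr0 // ltnW.
(* The sign picked up around the cycle, which decides between the two cases. *)
have sgnS : (-1) ^+ (m * s) ^+ s = (-1) ^+ (odd m && odd s) :> K.
  by rewrite -exprM -signr_odd !oddM -andbA andbb.
case: (boolP [|| _, _ | _]) => [good|]; last first.
  rewrite !negb_or !negbK => /and3P[os om K2]; rewrite !andbF.
  have K2' : 2%:R != 0 :> K by apply: contra K2 => K2; rewrite inE /= K2.
  have {}sgnS : (-1) ^+ (m * s) ^+ s = -1 :> K by rewrite sgnS om os.
  case: r rs => [|[|[|r]]] rs.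
  - by rewrite addn0; apply: Ext0_bad.
  - by rewrite addn1; apply: Ext1_bad.
  - by rewrite addn2; apply: Ext2_bad.
  by apply: (@Ext_dim_gt2 _ r.+3); rewrite // natrD N0 add0r.
have {}sgnS : (-1) ^+ (m * s) ^+ s = 1 :> K.
  rewrite sgnS; case/or3P: good => [/negPf-> | /negPf-> | K2].
  - by rewrite andbF.
  - by [].
  have /eqP : 2%:R = 0 :> K by apply/eqP; case/andP: K2.
  rewrite mulr2n addr_eq0 => /eqP e; rewrite -e.
  by case: (_ && _); rewrite ?expr1.
case: r rs => [|[|[|r]]] rs /=.
- by rewrite addn0 addn1; apply: Ext0_good.
- rewrite addn1 (_ : 2 * m * s + 4 = (m * s).+3 + (m * s).+1)%N; first exact: Ext1_good.
  by rewrite -mulnA mul2n -addnn !addSn !addnS addn0.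
- by rewrite addn2 addn3; apply: Ext2_good.
by apply: (@Ext_dim_gt2 _ r.+3); rewrite // natrD N0 add0r.
Qed.

End Cochains.

End Resolution.

End Koszul.

(** * The algebra of the circular quiver has a frame *)

Lemma linear4 (R : pzRingType) (U V : lmodType R) (f : U -> V) u1 u2 u3 u4 v1 v2 v3 v4 :
  linear f -> f u1 = v1 -> f u2 = v2 -> f u3 = v3 -> f u4 = v4 ->
  forall a b c d, f (a *: u1 + b *: u2 + c *: u3 + d *: u4) =
    a *: v1 + b *: v2 + c *: v3 + d *: v4.
Proof.
move=> fL <- <- <- <- a b c d; rewrite -[f]/(mk_linear fL : U -> V).
by rewrite !linearD !linearZ.
Qed.

Lemma mulr_sum_pick (R : pzRingType) (I : finType) (a : R) (F : I -> R) i :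
  (forall k, a * F k = if i == k then F k else 0) -> a * (\sum_k F k) = F i.
Proof.
move=> aF; rewrite mulr_sumr (bigD1 i) //= aF eqxx big1 ?addr0 // => k ki.
by rewrite aF eq_sym (negPf ki).
Qed.

Lemma mulr_pick_sum (R : pzRingType) (I : finType) (a : R) (F : I -> R) i :
  (forall k, F k * a = if i == k then F k else 0) -> (\sum_k F k) * a = F i.
Proof.
move=> aF; rewrite mulr_suml (bigD1 i) //= aF eqxx big1 ?addr0 // => k ki.
by rewrite aF eq_sym (negPf ki).
Qed.

Section FrameOperators.
Variables (K : fieldType) (s : nat).
Local Notation L := (frame_space K s).
Implicit Type l : L.

Definition lmul_x l : L := fun k p q => if p then l (k + 1) false q else 0.
Definition lmul_y l : L := fun k p q =>
  if q then (-1) ^+ p * l (k + 1) p false else 0.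
Definition lmul_e (v : 'Z_s) l : L := fun k p q => if k == v then l k p q else 0.
Definition frame_one : L := fun k p q => (~~ p && ~~ q)%:R.

Lemma frameP l l' : (forall k p q, l k p q = l' k p q) -> l = l'.
Proof.
by move=> ll'; apply/funext => k; apply/funext => p; apply/funext => q.
Qed.

Lemma frameE c l l' k p q : (c *: l + l' : L) k p q = c * l k p q + l' k p q.
Proof. by []. Qed.

Lemma lmul_x_linear : linear lmul_x.
Proof.
by move=> c l l'; apply: frameP => k [] q; rewrite frameE /lmul_x //= mulr0 addr0.
Qed.
Lemma lmul_y_linear : linear lmul_y.
Proof.
move=> c l l'; apply: frameP => k p []; rewrite frameE /lmul_y //= ?mulr0 ?addr0 //.
by rewrite frameE mulrDr mulrCA.
Qed.
Lemma lmul_e_linear v : linear (lmul_e v).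
Proof.
move=> c l l'; apply: frameP => k p q; rewrite frameE /lmul_e.
by case: eqP => _; rewrite ?mulr0 ?addr0.
Qed.

Definition lmul_arrow (c : bool) : L -> L := if c then lmul_y else lmul_x.
Lemma lmul_arrow_linear c : linear (lmul_arrow c).
Proof. by case: c; [apply: lmul_y_linear | apply: lmul_x_linear]. Qed.

(** Left multiplication by a path on the coordinates of an exterior algebra over
    the cycle. *)
Fixpoint path_act (v : 'Z_s) (w : seq ('Z_s * bool)) l : L :=
  if w is a :: w' then lmul_e v (lmul_arrow a.2 (path_act (a.1 + 1) w' l)) else lmul_e v l.

Lemma path_act_linear v w : linear (path_act v w).
Proof.
elim: w v => [|a w IH] v /=; first exact: lmul_e_linear.
by move=> c l l'; rewrite IH lmul_arrow_linear lmul_e_linear.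
Qed.

Lemma lmul_e_e v v' l : lmul_e v (lmul_e v' l) = if v == v' then lmul_e v l else 0.
Proof.
apply: frameP => k p q; rewrite /lmul_e.
have [->|kv] := eqVneq k v; last by case: eqP => //; case: eqP kv.
by case: eqP => //; rewrite eqxx.
Qed.

Lemma lmul_e_path_act v v' w l : lmul_e v (path_act v' w l) = if v == v' then path_act v w l else 0.
Proof. by case: w => [|a w] /=; rewrite lmul_e_e; case: eqP. Qed.

Lemma path_act_cat v w1 w2 v' l :
  path_act v w1 (path_act v' w2 l) =
  if last v (map (fun a => a.1 + 1) w1) == v' then path_act v (w1 ++ w2) l else 0.
Proof.
elim: w1 v => [|a w1 IH] v /=; first exact: lmul_e_path_act.
rewrite IH; case: eqP => // _.
have a0 : lmul_arrow a.2 0 = 0.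
  have := lmul_arrow_linear a.2 (-1) 0 0; rewrite scaler0 addr0 => ->.
  by rewrite scaleN1r addNr.
rewrite a0; apply: frameP => k p q.
by rewrite /lmul_e if_same.
Qed.

Lemma lmul_x_e v l : lmul_x (lmul_e (v + 1) l) = lmul_e v (lmul_x l).
Proof.
by apply: frameP => k [] q; rewrite /lmul_x /lmul_e ?if_same // (inj_eq (addIr _)).
Qed.
Lemma lmul_y_e v l : lmul_y (lmul_e (v + 1) l) = lmul_e v (lmul_y l).
Proof.
apply: frameP => k p []; rewrite /lmul_y /lmul_e ?if_same // (inj_eq (addIr _)).
by case: eqP => _; rewrite ?mulr0.
Qed.
Lemma lmul_x_x l : lmul_x (lmul_x l) = 0.
Proof. by apply: frameP => k [] q. Qed.
Lemma lmul_y_y l : lmul_y (lmul_y l) = 0.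
Proof. by apply: frameP => k p []; rewrite /lmul_y //= mulr0. Qed.
Lemma lmul_x_y l : lmul_x (lmul_y l) + lmul_y (lmul_x l) = 0.
Proof.
apply: frameP => k p q; rewrite -[(_ + _) k p q]/(lmul_x (lmul_y l) k p q + lmul_y (lmul_x l) k p q).
by case: p q => [] [] /=; rewrite /lmul_x /lmul_y ?mulr0 ?addr0 // expr0 expr1 mul1r mulN1r subrr.
Qed.

Lemma sum_lmul_e l : \sum_v lmul_e v l = l.
Proof.
apply: frameP => k p q.
have sumE (F : 'Z_s -> L) : (\sum_v F v) k p q = \sum_v F v k p q.
  by elim/big_rec2: _ => // v a b _ <-.
rewrite sumE (bigD1 k) //= big1 ?addr0 => [|v vk]; first by rewrite /lmul_e eqxx.
by rewrite /lmul_e eq_sym (negPf vk).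
Qed.

End FrameOperators.

Section Span.
Variables (K : fieldType) (s : nat) (A : algType K) (x y : A) (e : 'Z_s -> A).
Local Notation L := (frame_space K s).
Hypotheses (xx : x * x = 0) (yy : y * y = 0) (yx : y * x = - (x * y)).
Hypotheses (xe : forall k, x * e (k + 1) = e k * x).
Hypotheses (ye : forall k, y * e (k + 1) = e k * y).
Hypotheses (ee : forall i k, e i * e k = if i == k then e i else 0).

Definition of_frame (l : L) : A := \sum_k (l k false false *: e k +
  l k true false *: (e k * x) + l k false true *: (e k * y) +
  l k true true *: (e k * x * y)).

Lemma of_frame_linear : linear of_frame.
Proof.
move=> c l l'; rewrite /of_frame scaler_sumr -big_split; apply: eq_bigr => k _.
rewrite !frameE !scalerDl -!scalerA !scalerDr.
by rewrite [RHS](AC (4*4) (((1*5)*(2*6))*(3*7)*(4*8))).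
Qed.

Lemma sum_next (F : 'Z_s -> A) : \sum_k F k = \sum_k F (k + 1).
Proof. by rewrite (reindex_inj (addIr 1)). Qed.

Lemma of_frame_e i l : e i * of_frame l = of_frame (lmul_e i l).
Proof.
rewrite /of_frame mulr_sumr; apply: eq_bigr => k _; rewrite /lmul_e.
rewrite !mulrDr -!scalerAr !mulrA ee [k == i]eq_sym; case: eqP => [->|_] //.
by rewrite !mul0r !scaler0 !scale0r.
Qed.

Lemma of_frame_x l : x * of_frame l = of_frame (lmul_x l).
Proof.
rewrite /of_frame mulr_sumr sum_next; apply: eq_bigr => k _; rewrite /lmul_x.
rewrite !mulrDr -!scalerAr !mulrA xe -[e k * x * x]mulrA xx mulr0 mul0r.
by rewrite !scaler0 !scale0r add0r !addr0.
Qed.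

Lemma of_frame_y l : y * of_frame l = of_frame (lmul_y l).
Proof.
rewrite /of_frame mulr_sumr sum_next; apply: eq_bigr => k _; rewrite /lmul_y.
rewrite !mulrDr -!scalerAr !mulrA ye -[e k * y * x]mulrA -[e k * y * y]mulrA yx yy.
rewrite mulr0 mulrN mulNr -!mulrA yy !mulr0 oppr0 !scaler0 !addr0.
by rewrite !scale0r !add0r expr0 expr1 mul1r mulN1r scaleNr scalerN.
Qed.

Lemma of_frame_one v : of_frame (lmul_e v (@frame_one K s)) = e v.
Proof.
rewrite /of_frame (bigD1 v) //= big1 ?addr0 => [|k kv];
  rewrite /lmul_e /frame_one /= ?eqxx ?(negPf kv) /= ?scale0r ?scale1r ?addr0 //.
Qed.

End Span.

Section LambdaFrame.
Variables (K : fieldType) (s : nat).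
Local Notation L := (frame_space K s).
Local Notation Q := (circular_quiver s).
Local Notation KG := (path_algebra K Q).
Local Notation Lam := (Lambda K s).
Local Notation one_coord := (@frame_one K s).
Implicit Type l : L.

(** A representation of the path algebra that satisfies the relations of Lambda.
    It separates the monomials e_k x^p y^q, which gives their independence. *)
Definition path_rep (u : KG) l : L :=
  lext (fun p : qpath Q => path_act (val p).1 (val p).2 l) u.

Lemma path_rep_path p l : path_rep (path_elt K p) l = path_act (val p).1 (val p).2 l.
Proof. exact: lextU. Qed.

Lemma path_rep_linearl l : linear (path_rep^~ l).
Proof. by move=> c u v; rewrite /path_rep linearP. Qed.

Lemma path_rep_linearr u : linear (path_rep u).
Proof.
move=> c l l'; rewrite /path_rep /lext scaler_sumr -big_split /=.
apply: eq_bigr => p _.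
by rewrite path_act_linear scalerDr !scalerA mulrC.
Qed.

Lemma path_rep_sum (I : Type) (r : seq I) (P : pred I) (F : I -> KG) l :
  path_rep (\sum_(i <- r | P i) F i) l = \sum_(i <- r | P i) path_rep (F i) l.
Proof. exact: (raddf_sum (mk_linear (path_rep_linearl l))). Qed.

Lemma path_repM u v l : path_rep (u * v) l = path_rep u (path_rep v l).
Proof.
move: u; apply: malg_linP => [c u u'|c u u'|p].
- by rewrite mulrDl -scalerAl path_rep_linearl.
- exact: path_rep_linearl.
move: v; apply: malg_linP => [c u u'|c u u'|q].
- by rewrite mulrDr -scalerAr path_rep_linearl.
- by rewrite path_rep_linearl path_rep_linearr.
rewrite (basis_algM (path_table K Q)) -/(path_elt K p) -/(path_elt K q).
rewrite !path_rep_path path_act_cat /=.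
rewrite (_ : (last _ _ == _) = (path_target p == path_source q)) //.
have [pq|pq] := boolP (path_target p == path_source q).
  by rewrite (path_mul_cat K pq) -/(path_elt K _) path_rep_path.
rewrite path_mul0 //; exact: (linear0 (mk_linear (path_rep_linearl l))).
Qed.

Definition vertex_elt (v : 'Z_s) : KG := path_elt K (@trivial_path Q v).

Lemma path_rep_vertex v l : path_rep (vertex_elt v) l = lmul_e v l.
Proof. by rewrite path_rep_path. Qed.
Lemma path_rep_arrow v c l : path_rep (arrow_elt K v c) l = lmul_e v (lmul_arrow c l).
Proof.
rewrite path_rep_path /=; case: c; rewrite /= ?lmul_x_e ?lmul_y_e lmul_e_e eqxx //.
Qed.
Lemma path_rep_x l : path_rep (x_elt K s) l = lmul_x l.
Proof.
rewrite path_rep_sum -[RHS]sum_lmul_e; apply: eq_bigr => v _.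
exact: path_rep_arrow.
Qed.
Lemma path_rep_y l : path_rep (y_elt K s) l = lmul_y l.
Proof.
rewrite path_rep_sum -[RHS]sum_lmul_e; apply: eq_bigr => v _.
exact: path_rep_arrow.
Qed.
Lemma path_rep_one l : path_rep 1 l = l.
Proof.
rewrite -[RHS]sum_lmul_e path_rep_sum; apply: eq_bigr => v _; exact: path_rep_vertex.
Qed.

Lemma path_rep_ideal u l : Lambda_ideal K s u -> path_rep u l = 0.
Proof.
move=> /= Iu; move: u Iu l.
have rL l := path_rep_linearl l.
move=> u Iu l; apply: (gen_ideal_ker (rL l)) Iu => a g b rg.
rewrite !path_repM; have -> : path_rep g (path_rep b l) = 0; last exact: (linear0 (mk_linear (path_rep_linearr a))).
move: (path_rep b l) => l'; case: rg => [||].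
- by apply: etrans (path_repM _ _ _) (etrans (congr1 (path_rep _) (path_rep_x l')) _); rewrite path_rep_x lmul_x_x.
- have -> : path_rep (x_elt K s * y_elt K s + y_elt K s * x_elt K s) l' =
    path_rep (x_elt K s * y_elt K s) l' + path_rep (y_elt K s * x_elt K s) l'.
    exact: (linearD (mk_linear (rL l'))).
  rewrite -[RHS](lmul_x_y l'); congr (_ + _).
    exact: etrans (path_repM _ _ _) (etrans (congr1 (path_rep _) (path_rep_y l')) (path_rep_x _)).
  exact: etrans (path_repM _ _ _) (etrans (congr1 (path_rep _) (path_rep_x l')) (path_rep_y _)).
by apply: etrans (path_repM _ _ _) (etrans (congr1 (path_rep _) (path_rep_y l')) _); rewrite path_rep_y lmul_y_y.
Qed.

Definition Lambda_rep (u : Lam) l : L := path_rep (repr u) l.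

Lemma Lambda_repE u l : Lambda_rep (alg_proj (Lambda_ideal K s) u) l = path_rep u l.
Proof.
have /alg_projP h := alg_proj_repr (alg_proj (Lambda_ideal K s) u).
have /eqP := etrans (esym (linearB (mk_linear (path_rep_linearl l)) _ _)) (path_rep_ideal l h).
by rewrite subr_eq0 => /eqP.
Qed.

Local Notation pi := (alg_proj (Lambda_ideal K s)).

Lemma pi_linear : linear (pi : KG -> Lam).
Proof. by move=> c u v; rewrite /alg_proj linearP. Qed.

Lemma Lambda_repM u v l : Lambda_rep (u * v) l = Lambda_rep u (Lambda_rep v l).
Proof.
rewrite -(alg_proj_repr u) -(alg_proj_repr v).
by rewrite -[X in Lambda_rep X l]alg_projM !Lambda_repE path_repM.
Qed.

Lemma Lambda_rep_linearl l : linear (Lambda_rep^~ l).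
Proof.
move=> c u v; rewrite -(alg_proj_repr u) -(alg_proj_repr v) -pi_linear !Lambda_repE.
exact: path_rep_linearl.
Qed.

Lemma Lambda_rep1 l : Lambda_rep 1 l = l.
Proof. by rewrite -[RHS]path_rep_one -Lambda_repE. Qed.

Definition rmul_x l : L := fun k p q => if p then (-1) ^+ q * l k false q else 0.
Definition rmul_y l : L := fun k p q => if q then l k p false else 0.
Definition rmul_e v l : L := fun k p q => if k + p%:R + q%:R == v then l k p q else 0.

(** Right multiplications commute with all left multiplications; hence the
    coordinates of u * x are those of u, multiplied by x from the right
    ([Lambda_coordMx]). *)
Definition commutes (g : L -> L) := linear g /\ forall v c l,
  g (lmul_e v l) = lmul_e v (g l) /\ g (lmul_arrow c l) = lmul_arrow c (g l).

Lemma path_act_commutes g : commutes g -> forall v w l, g (path_act v w l) = path_act v w (g l).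
Proof.
move=> [_ gC] v w l; elim: w v => [|a w IH] v /=; first by have [] := gC v true l.
by rewrite (gC v true _).1 (gC v a.2 _).2 IH.
Qed.

Lemma Lambda_rep_commutes g : commutes g -> forall u l, g (Lambda_rep u l) = Lambda_rep u (g l).
Proof.
move=> gC u l; rewrite /Lambda_rep; move: (repr u : {malg K[_]}).
apply: malg_linP => [c f f'|c f f'|p].
- by rewrite path_rep_linearl gC.1.
- by rewrite path_rep_linearl.
by rewrite -/(path_elt K p) !path_rep_path path_act_commutes.
Qed.

Lemma rmul_x_commutes : commutes rmul_x.
Proof.
split=> [c l l'|v c l].
  by apply: frameP => k [] q; rewrite frameE /rmul_x ?mulr0 ?addr0 // frameE mulrDr mulrCA.
split; apply: frameP => k p q; rewrite /rmul_x /lmul_e.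
  by case: p; case: eqP; rewrite ?mulr0.
case: c; rewrite /lmul_arrow /lmul_x /lmul_y; case: p q => [] []; rewrite /= ?mulr0 ?expr0 ?expr1 ?mul1r //.
Qed.
Lemma rmul_y_commutes : commutes rmul_y.
Proof.
split=> [c l l'|v c l].
  by apply: frameP => k p []; rewrite frameE /rmul_y ?mulr0 ?addr0.
split; apply: frameP => k p q; rewrite /rmul_y /lmul_e.
  by case: q; case: eqP.
by case: c; rewrite /lmul_arrow /lmul_x /lmul_y; case: p q => [] []; rewrite /= ?mulr0.
Qed.
Lemma rmul_e_commutes i : commutes (rmul_e i).
Proof.
split=> [c l l'|v c l].
  by apply: frameP => k p q; rewrite frameE /rmul_e; case: eqP; rewrite ?mulr0 ?addr0.
split; apply: frameP => k p q; rewrite /rmul_e /lmul_e.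
  by case: eqP; case: eqP.
case: c; rewrite /lmul_arrow /lmul_x /lmul_y; case: p q => [] []; rewrite /= ?if_same ?addr0 ?mulr0 //.
all: by case: eqP; rewrite ?mulr0.
Qed.

Definition Lambda_x : Lam := pi (x_elt K s).
Definition Lambda_y : Lam := pi (y_elt K s).
Definition Lambda_e v : Lam := pi (vertex_elt v).

(** The image of the coordinates of 1 under u. *)
Definition Lambda_coord (u : Lam) : L := Lambda_rep u one_coord.

Lemma Lambda_rep_x l : Lambda_rep Lambda_x l = lmul_x l. Proof. by rewrite Lambda_repE path_rep_x. Qed.
Lemma Lambda_rep_y l : Lambda_rep Lambda_y l = lmul_y l. Proof. by rewrite Lambda_repE path_rep_y. Qed.
Lemma Lambda_rep_e v l : Lambda_rep (Lambda_e v) l = lmul_e v l. Proof. by rewrite Lambda_repE path_rep_vertex. Qed.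

Lemma lmul_x1 : lmul_x one_coord = rmul_x one_coord.
Proof.
by apply: frameP => k [] []; rewrite /lmul_x /rmul_x /frame_one /= ?mulr0 ?mulr1.
Qed.
Lemma lmul_y1 : lmul_y one_coord = rmul_y one_coord.
Proof.
by apply: frameP => k [] []; rewrite /lmul_y /rmul_y /frame_one /= ?mulr0 ?mulr1.
Qed.
Lemma lmul_e1 v : lmul_e v one_coord = rmul_e v one_coord.
Proof.
apply: frameP => k [] []; rewrite /lmul_e /rmul_e /frame_one /= ?if_same //.
by rewrite !addr0.
Qed.

Lemma Lambda_coordMx u : Lambda_coord (u * Lambda_x) = rmul_x (Lambda_coord u).
Proof. by rewrite /Lambda_coord Lambda_repM Lambda_rep_x lmul_x1 (Lambda_rep_commutes rmul_x_commutes). Qed.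
Lemma Lambda_coordMy u : Lambda_coord (u * Lambda_y) = rmul_y (Lambda_coord u).
Proof. by rewrite /Lambda_coord Lambda_repM Lambda_rep_y lmul_y1 (Lambda_rep_commutes rmul_y_commutes). Qed.
Lemma Lambda_coordMe u v : Lambda_coord (u * Lambda_e v) = rmul_e v (Lambda_coord u).
Proof. by rewrite /Lambda_coord Lambda_repM Lambda_rep_e lmul_e1 (Lambda_rep_commutes (rmul_e_commutes v)). Qed.

Definition Lambda_of_coord : L -> Lam := of_frame Lambda_x Lambda_y Lambda_e.

(** Linear independence of the monomials. *)
Lemma Lambda_of_coordK : cancel Lambda_of_coord Lambda_coord.
Proof.
move=> l.
have cL : linear Lambda_coord by apply: Lambda_rep_linearl.
have cS (F : 'Z_s -> Lam) : Lambda_coord (\sum_k F k) = \sum_k Lambda_coord (F k).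
  exact: (raddf_sum (mk_linear cL)).
have ce v : Lambda_coord (Lambda_e v) = lmul_e v one_coord by apply: Lambda_rep_e.
rewrite /Lambda_of_coord /of_frame cS -[RHS]sum_lmul_e; apply: eq_bigr => k _.
have cx : Lambda_coord (Lambda_e k * Lambda_x) = rmul_x (lmul_e k one_coord) :=
  etrans (Lambda_coordMx _) (congr1 rmul_x (ce k)).
have cy : Lambda_coord (Lambda_e k * Lambda_y) = rmul_y (lmul_e k one_coord) :=
  etrans (Lambda_coordMy _) (congr1 rmul_y (ce k)).
have cxy : Lambda_coord (Lambda_e k * Lambda_x * Lambda_y) = rmul_y (rmul_x (lmul_e k one_coord)) :=
  etrans (Lambda_coordMy _) (congr1 rmul_y cx).
apply: etrans (linear4 cL (ce k) cx cy cxy _ _ _ _) _; apply: frameP => k' p q.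
rewrite -[LHS]/(l k false false * lmul_e k one_coord k' p q + l k true false * rmul_x (lmul_e k one_coord) k' p q +
  l k false true * rmul_y (lmul_e k one_coord) k' p q + l k true true * rmul_y (rmul_x (lmul_e k one_coord)) k' p q).
rewrite /rmul_x /rmul_y /lmul_e /frame_one; have [->|_] := eqVneq k' k; case: p q => [] [];
  by rewrite /= ?(expr0, expr1, mulr0, mulr1, mul1r, addr0, add0r).
Qed.

Lemma path_eltM (p q : qpath Q) : path_elt K p * path_elt K q = path_mul K p q.
Proof. exact: (basis_algM (path_table K Q)). Qed.

Lemma vertex_vertex i k : vertex_elt i * vertex_elt k = if i == k then vertex_elt i else 0.
Proof.
apply: etrans (path_eltM _ _) _; case: eqP => [->|/eqP ik].
  exact: path_mulE.
exact: path_mul0.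
Qed.

Lemma vertex_arrow i k c : vertex_elt i * arrow_elt K k c = if i == k then arrow_elt K k c else 0.
Proof.
apply: etrans (path_eltM _ _) _; case: eqP => [->|/eqP ik].
  exact: path_mulE.
exact: path_mul0.
Qed.

Lemma arrow_vertex i k c : arrow_elt K k c * vertex_elt i = if k + 1 == i then arrow_elt K k c else 0.
Proof.
apply: etrans (path_eltM _ _) _; case: eqP => [ki|/eqP ik].
  exact: path_mulE.
exact: path_mul0.
Qed.

Definition gen_elt (c : bool) : KG := \sum_i arrow_elt K i c.

Lemma vertex_gen i c : vertex_elt i * gen_elt c = arrow_elt K i c.
Proof. exact: mulr_sum_pick (fun k => vertex_arrow i k c). Qed.

Lemma gen_vertex i c : gen_elt c * vertex_elt (i + 1) = arrow_elt K i c.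
Proof.
apply: mulr_pick_sum => k; apply: etrans (arrow_vertex _ _ _) _.
by rewrite (inj_eq (addIr _)) eq_sym.
Qed.

Lemma piM u v : pi (u * v) = pi u * pi v :> Lam. Proof. exact: alg_projM. Qed.

Lemma pi_rel u : Lambda_rel u -> pi u = 0 :> Lam.
Proof.
move=> ru; rewrite -(linear0 (mk_linear pi_linear)); apply/alg_projP; rewrite subr0.
by move=> J _; apply.
Qed.

Lemma Lambda_xx : Lambda_x * Lambda_x = 0.
Proof. exact: etrans (esym (piM _ _)) (pi_rel (LambdaXX K s)). Qed.
Lemma Lambda_yy : Lambda_y * Lambda_y = 0.
Proof. exact: etrans (esym (piM _ _)) (pi_rel (LambdaYY K s)). Qed.
Lemma Lambda_yx : Lambda_y * Lambda_x = - (Lambda_x * Lambda_y).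
Proof.
apply/eqP; rewrite -addr_eq0 addrC; apply/eqP.
have piD u v : pi (u + v) = pi u + pi v :> Lam := linearD (mk_linear pi_linear) u v.
have piMD a b c d : pi (a * b + c * d) = pi a * pi b + pi c * pi d :> Lam :=
  etrans (piD _ _) (congr2 +%R (piM a b) (piM c d)).
exact: etrans (esym (piMD _ _ _ _)) (pi_rel (LambdaXY K s)).
Qed.
Lemma Lambda_xe k : Lambda_x * Lambda_e (k + 1) = Lambda_e k * Lambda_x.
Proof.
apply: etrans (esym (piM _ _)) (etrans (congr1 _ _) (piM _ _)).
exact: etrans (gen_vertex k false) (esym (vertex_gen k false)).
Qed.
Lemma Lambda_ye k : Lambda_y * Lambda_e (k + 1) = Lambda_e k * Lambda_y.
Proof.
apply: etrans (esym (piM _ _)) (etrans (congr1 _ _) (piM _ _)).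
exact: etrans (gen_vertex k true) (esym (vertex_gen k true)).
Qed.
Lemma Lambda_ee i k : Lambda_e i * Lambda_e k = if i == k then Lambda_e i else 0.
Proof.
apply: etrans (esym (piM _ _)) _; rewrite vertex_vertex; case: eqP => // _.
exact: (linear0 (mk_linear pi_linear)).
Qed.

Lemma Lambda_arrow k c : pi (arrow_elt K k c) = Lambda_e k * (if c then Lambda_y else Lambda_x) :> Lam.
Proof.
apply: etrans (congr1 _ (esym (vertex_gen k c))) (etrans (piM _ _) _).
by case: c.
Qed.

Lemma path_cons (v i : 'Z_s) c (w : seq ('Z_s * bool))
    (vw : @composable Q v ((i, c) :: w)) (iw : @composable Q (i + 1) w) :
  path_elt K (exist (fun x => composable x.1 x.2) (v : vertex Q, (i, c) :: w) vw : qpath Q) =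
  arrow_elt K i c *
    path_elt K (exist (fun x => composable x.1 x.2) (i + 1 : vertex Q, w) iw : qpath Q).
Proof.
have /andP[/eqP iv _] := vw.
apply/esym/(etrans (path_eltM _ _)); apply: path_mulE => //=.
by rewrite -iv.
Qed.

(** The monomials span: their span contains the vertices and is stable under left
    multiplication by arrows. *)
Lemma path_of_frame (v : 'Z_s) w (vw : @composable Q v w) :
  exists l, pi (path_elt K (exist (fun x => composable x.1 x.2) (v : vertex Q, w) vw : qpath Q)) = Lambda_of_coord l.
Proof.
elim: w v vw => [|[i c] w IH] v vw.
  exists (lmul_e v one_coord); apply: etrans _ (esym (of_frame_one Lambda_x Lambda_y Lambda_e v)).
  by congr (pi (path_elt K _)); apply: val_inj.
have iw : @composable Q (i + 1) w by have /andP[] := vw.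
have [l lE] := IH _ iw.
exists (lmul_e i (lmul_arrow c l)).
apply: etrans (congr1 _ (path_cons vw iw)) _.
apply: etrans (etrans (piM _ _) (congr2 *%R (Lambda_arrow i c) lE)) _.
apply: etrans (esym (mulrA _ _ _)) (etrans (congr1 ( *%R (Lambda_e i)) _) (of_frame_e _ _ Lambda_ee _ _)).
case: c {vw}; first exact: (of_frame_y Lambda_yy Lambda_yx Lambda_ye).
exact: (@of_frame_x K s Lam Lambda_x Lambda_y Lambda_e Lambda_xx Lambda_xe l).
Qed.

Lemma Lambda_coordK : cancel Lambda_coord Lambda_of_coord.
Proof.
move=> u; suff [l ->] : exists l, u = Lambda_of_coord l by rewrite Lambda_of_coordK.
rewrite -(alg_proj_repr u); move: (repr u : {malg K[_]}) => {u} u.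
exists (Lambda_coord (pi u)); move: u.
have cL : linear Lambda_coord by apply: Lambda_rep_linearl.
apply: malg_linP => [c u u'|c u u'|p].
- exact: pi_linear.
- rewrite pi_linear cL; exact: of_frame_linear.
have [l lE] : exists l, pi (path_elt K p) = Lambda_of_coord l.
  by case: p => -[v w] vw; apply: path_of_frame.
by rewrite -/(path_elt K p) lE Lambda_of_coordK.
Qed.

Lemma Lambda_coord1 k p q : Lambda_coord 1 k p q = (~~ p && ~~ q)%:R.
Proof. by rewrite /Lambda_coord Lambda_rep1. Qed.

Definition Lambda_frame : exterior_frame s Lam.
Proof.
refine (@ExteriorFrame K s Lam Lambda_x Lambda_y Lambda_e Lambda_coord
  Lambda_of_coord (Lambda_rep_linearl one_coord) Lambda_coordK Lambda_of_coordK Lambda_coord1 _ _ _ _ _ _)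
  => [u|u|u|u|i u|i u] k p q.
- by rewrite /Lambda_coord Lambda_repM Lambda_rep_x.
- by rewrite /Lambda_coord Lambda_repM Lambda_rep_y.
- by rewrite Lambda_coordMx.
- by rewrite Lambda_coordMy.
- by rewrite /Lambda_coord Lambda_repM Lambda_rep_e.
- by rewrite Lambda_coordMe.
Defined.
End LambdaFrame.

(** * The theorem *)

Theorem theorem3p9 (K : closedFieldType) (s m r : nat)
    (hs : (3 <= s)%N) (hr : (r <= s - 1)%N) :
  has_dim (HH (Lambda K s) (m * s + r))
    (let good := [|| ~~ odd s, ~~ odd m | 2%N \in [pchar K]] in
     if (r == 0%N) && good then m * s + 1
     else if (r == 1%N) && good then 2 * m * s + 4
     else if (r == 2%N) && good then m * s + 3
     else 0)%N.
Proof.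
have rs : (r < s)%N by apply: leq_ltn_trans hr _; rewrite ltn_subrL (leq_trans _ hs).
apply: Ext_independent.
apply: (@Ext_dim K s _ (Lambda_frame K s) _ (enveloping_presentation _)
  (regular_bimodule (Lambda K s)) id id) => //.
exact: bimod_tensorE.
Qed.
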